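(* Let $d\ge 1$ and assume $1<p<\infty$ and $s>1+\frac dp$. Then for any $M>0$, there exist $f,g\in\mathcal S(\mathbb R^d)$ such that $$\|J^s(fg)-fJ^sg\|_p>M\Bigl(\|J^sf\|_p\|g\|_{\mathrm{BMO}}+\|J^{s-1}g\|_p\|\partial f\|_\infty\Bigr).$$
   Context: $\mathcal S(\mathbb R^d)$ is the space of Schwartz functions, $\|\cdot\|_p$ the $L^p(\mathbb R^d)$ norm. $J^s=(1-\Delta)^{s/2}$ is the Fourier multiplier with symbol $(1+|\xi|^2)^{s/2}$. $\partial=(\partial_1,\dots,\partial_d)$ is the gradient; norms of vector-valued functions are taken componentwise. The BMO norm is $\|u\|_{\mathrm{BMO}}=\sup_Q\frac1{|Q|}\int_Q|u-u_Q|\,dy$ ($u_Q$ the average over $Q$, supremum over all cubes $Q\subset\mathbb R^d$). *)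

(* Defs.v *)
From HB Require Import structures.
From mathcomp Require Import all_boot all_order all_algebra.
From mathcomp Require Import complex.
From mathcomp Require Import all_classical all_reals all_analysis.

Set Implicit Arguments.
Unset Strict Implicit.
Unset Printing Implicit Defensive.

Import Order.TTheory GRing.Theory Num.Theory.
Import numFieldNormedType.Exports.

Local Open Scope classical_set_scope.
Local Open Scope ring_scope.

Definition measure_rV_display : measure_display.
Proof. exact: (measure_tuple_display default_measure_display). Qed.

Definition rV_coord {R : realType} {n : nat} (i : 'I_n) (x : 'rV[R]_n) :
  measurableTypeR R := x ord0 i.

Section measurable_rV.
Context {R : realType} (n : nat).

Let rV_set0 : g_sigma_preimage (@rV_coord R n) set0.
Proof. exact: sigma_algebra0. Qed.

Let rV_setC A : g_sigma_preimage (@rV_coord R n) A ->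
  g_sigma_preimage (@rV_coord R n) (~` A).
Proof. exact: sigma_algebraC. Qed.

Let rV_bigcup (F : _^nat) : (forall i, g_sigma_preimage (@rV_coord R n) (F i)) ->
  g_sigma_preimage (@rV_coord R n) (\bigcup_i (F i)).
Proof. exact: sigma_algebra_bigcup. Qed.

(** Generated by the coordinates, hence the Borel sigma-algebra. *)
HB.instance Definition _ := @isMeasurable.Build measure_rV_display
  'rV[R]_n (g_sigma_preimage (@rV_coord R n)) rV_set0 rV_setC rV_bigcup.

End measurable_rV.

Section measurability_rV.
Context {R : realType}.

Lemma measurable_rV_coord n (i : 'I_n) :
  measurable_fun [set: 'rV[R]_n] (@rV_coord R n i).
Proof.
move=> _ Y mY; rewrite setTI; apply: sub_sigma_algebra => /=.
case: n i => [[]//|n] i; rewrite -bigcup_mkord_ord.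
exists i => /=; first exact: ltn_ord.
by exists Y => //; rewrite inord_val setTI.
Qed.

Lemma measurable_rVP d (T : measurableType d) n (f : T -> 'rV[R]_n) :
  (forall i, measurable_fun [set: T] (fun x => rV_coord i (f x))) ->
  measurable_fun [set: T] f.
Proof.
case: n f => [|n] f mf; apply: (@measurability _ _ _ _ _ _
  (\big[setU/set0]_i preimage_set_system setT (@rV_coord R _ i) measurable)) => //.
  by move=> _ [A + <-]; rewrite big_ord0.
move=> _ [A + <-]; rewrite -bigcup_mkord_ord => -[i Ii [Y mY <-]].
by rewrite setTI; have := mf (inord i) measurableT Y mY.
Qed.

End measurability_rV.

Definition rV_cons {R : realType} {n : nat} (p : measurableTypeR R * 'rV[R]_n) :
  'rV[R]_n.+1 := \row_i oapp (p.2 ord0) p.1 (unlift ord0 i).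

Definition rV_uncons {R : realType} {n : nat} (x : 'rV[R]_n.+1) :
    measurableTypeR R * 'rV[R]_n :=
  (rV_coord ord0 x, \row_(j < n) rV_coord (lift ord0 j) x).

Section cons_measure.
Context {R : realType} (n : nat).

Lemma rV_cons0 (p : measurableTypeR R * 'rV[R]_n) :
  rV_coord ord0 (rV_cons p) = p.1.
Proof. by rewrite /rV_coord /rV_cons mxE unlift_none. Qed.

Lemma rV_consS (p : measurableTypeR R * 'rV[R]_n) (j : 'I_n) :
  rV_coord (lift ord0 j) (rV_cons p) = rV_coord j p.2.
Proof. by rewrite /rV_coord /rV_cons mxE liftK. Qed.

Lemma rV_consK : cancel (@rV_cons R n) rV_uncons.
Proof.
move=> [a x]; rewrite /rV_uncons rV_cons0; congr pair.
by apply/rowP => j; rewrite mxE rV_consS.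
Qed.

Lemma rV_unconsK : cancel rV_uncons (@rV_cons R n).
Proof.
move=> x; apply/rowP => i.
have [j ->|->] := unliftP ord0 i.
- by have := rV_consS (rV_uncons x) j; rewrite /rV_coord => ->; rewrite mxE.
- by have := rV_cons0 (rV_uncons x); rewrite /rV_coord => ->.
Qed.

Lemma measurable_rV_cons : measurable_fun setT (@rV_cons R n).
Proof.
apply: measurable_rVP => i.
have [j ->|->] := unliftP ord0 i.
- under eq_fun do rewrite rV_consS.
  exact: (measurableT_comp (measurable_rV_coord j) measurable_snd).
- under eq_fun do rewrite rV_cons0.
  exact: measurable_fst.
Qed.

Lemma measurable_rV_uncons : measurable_fun setT (@rV_uncons R n).
Proof.
apply: measurable_fun_pair; first exact: measurable_rV_coord.
apply: measurable_rVP => j; rewrite /rV_coord.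
under eq_fun do rewrite mxE.
exact: measurable_rV_coord.
Qed.

Variable m : {sigma_finite_measure set 'rV[R]_n -> \bar R}.

Definition cons_measure : set 'rV[R]_n.+1 -> \bar R :=
  pushforward (@lebesgue_measure R \x m)%E (@rV_cons R n).

Let cons_measure0 : cons_measure set0 = 0%E.
Proof. by rewrite /cons_measure /pushforward preimage_set0 measure0. Qed.

Let cons_measure_ge0 A : (0 <= cons_measure A)%E.
Proof. exact: (measure_ge0 (@lebesgue_measure R \x m)%E). Qed.

Let cons_measure_sigma_additive : semi_sigma_additive cons_measure.
Proof.
move=> F mF tF mUF; rewrite /cons_measure /pushforward preimage_bigcup.
apply: (@measure_semi_sigma_additive _ _ _ (@lebesgue_measure R \x m)%E).
- by move=> k; rewrite -[X in measurable X]setTI; exact: measurable_rV_cons.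
- apply/trivIsetP => /= i j _ _ ij; rewrite -preimage_setI.
  by move/trivIsetP : tF => /(_ _ _ _ _ ij) ->//; rewrite preimage_set0.
- by rewrite -preimage_bigcup -[X in measurable X]setTI;
    exact: measurable_rV_cons.
Qed.

HB.instance Definition _ := isMeasure.Build _ _ _ cons_measure
  cons_measure0 cons_measure_ge0 cons_measure_sigma_additive.

Let cons_measure_sigma_finite : sigma_finite setT cons_measure.
Proof.
have /sigma_finiteP[F [TF ndF mF]] := sigma_finiteT (@lebesgue_measure R).
have /sigma_finiteP[G [TG ndG mG]] := sigma_finiteT m.
exists (fun k => rV_uncons @^-1` (F k `*` G k)).
  rewrite -preimage_bigcup; apply/esym; rewrite -subTset => x _ /=.
  have [i _ Fi] : (\bigcup_k F k) (rV_uncons x).1 by rewrite -TF.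
  have [j _ Gj] : (\bigcup_k G k) (rV_uncons x).2 by rewrite -TG.
  exists (maxn i j) => //; split.
  - by move: Fi; exact/subsetPset/ndF/leq_maxl.
  - by move: Gj; exact/subsetPset/ndG/leq_maxr.
move=> k; have [mFk Fkoo] := mF k; have [mGk Gkoo] := mG k; split.
  rewrite -[X in measurable X]setTI.
  exact: (measurable_rV_uncons measurableT (measurableX mFk mGk)).
rewrite /cons_measure /pushforward.
rewrite (_ : _ @^-1` _ = F k `*` G k); last first.
  by rewrite -comp_preimage (_ : _ \o _ = id)//; apply/funext; exact: rV_consK.
by rewrite product_measure1E// lte_mul_pinfty// ge0_fin_numE.
Qed.

HB.instance Definition _ := Measure_isSigmaFinite.Build _ _ _ cons_measure
  cons_measure_sigma_finite.

End cons_measure.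

(** The only element of ['rV_0] is [0], and the measure on it is the unit mass;
    then L^(n+1) is the product of L^1 and L^n. *)
Fixpoint lebesgue_rV (R : realType) (n : nat) :
    {sigma_finite_measure set 'rV[R]_n -> \bar R} :=
  if n is k.+1 then cons_measure (lebesgue_rV R k) else dirac (0 : 'rV[R]_0).

Lemma lebesgue_rV_box (R : realType) (n : nat) (A : 'I_n -> set (measurableTypeR R)) :
  (forall i, measurable (A i)) ->
  lebesgue_rV R n [set x | forall i, A i (x ord0 i)] =
  (\prod_(i < n) lebesgue_measure (A i))%E.
Proof.
elim: n A => [|n IH] A mA.
  rewrite big_ord0 /= diracE mem_set//=; by case.
rewrite big_ord_recl -IH//= /cons_measure /pushforward.
have mB : measurable [set x : 'rV[R]_n | forall i, A (lift ord0 i) (x ord0 i)].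
  rewrite (_ : [set _ | _] =
    \bigcap_(i in [set: 'I_n]) (rV_coord i @^-1` A (lift ord0 i))); last first.
    by apply/seteqP; split => x /= Ax i; [move=> _; exact: Ax|exact: (Ax i)].
  apply: fin_bigcap_measurable => // i _.
  by rewrite -[X in measurable X]setTI;
    exact: (measurable_rV_coord i measurableT (mA _)).
rewrite -product_measure1E//; congr (product_measure1 _ _ _).
apply/seteqP; split => -[a x] /=.
  move=> Ax; split; first by have := Ax ord0; have := rV_cons0 (a, x);
    rewrite /rV_coord => ->.
  by move=> i; have := Ax (lift ord0 i); have := rV_consS (a, x) i;
    rewrite /rV_coord => ->.
move=> [Aa Ax] i; have [j ->|->] := unliftP ord0 i.
- by have := rV_consS (a, x) j; rewrite /rV_coord => ->; exact: Ax.
- by have := rV_cons0 (a, x); rewrite /rV_coord => ->.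
Qed.

Local Open Scope complex_scope.

Section complex_functions.
Context {R : realType} {d : nat}.
Implicit Types (f u : 'rV[R]_d -> R[i]) (x y xi : 'rV[R]_d).

Definition cintegral (D : set 'rV[R]_d) f : R[i] :=
  (\int[lebesgue_rV R d]_(x in D) complex.Re (f x)) +i*
  (\int[lebesgue_rV R d]_(x in D) complex.Im (f x)).

Definition cLnorm (p : \bar R) f : \bar R :=
  Lnorm (lebesgue_rV R d) p (fun x => (Normc.normc (f x))%:E).

Definition partial (i : 'I_d) (v : 'rV[R]_d -> R^o) : 'rV[R]_d -> R^o :=
  fun x => 'D_(delta_mx ord0 i) v x.

Definition cpartial (i : 'I_d) f : 'rV[R]_d -> R[i] :=
  fun x => partial i (fun y => complex.Re (f y)) x +i*
           partial i (fun y => complex.Im (f y)) x.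

(** Mixed partial derivatives are indexed by words of directions instead of
    multi-indices; for smooth functions the order of the letters is
    irrelevant. *)
Definition iter_partial (w : seq 'I_d) (v : 'rV[R]_d -> R^o) :
  'rV[R]_d -> R^o := foldr partial v w.

Definition smooth (v : 'rV[R]_d -> R^o) : Prop :=
  forall (w : seq 'I_d) x, differentiable (iter_partial w v) x.

Definition schwartz_real (v : 'rV[R]_d -> R^o) : Prop :=
  smooth v /\
  forall (alpha : 'I_d -> nat) (w : seq 'I_d), exists C : R, forall x,
    `|(\prod_(i < d) x ord0 i ^+ alpha i) * iter_partial w v x| <= C.

Definition schwartz f : Prop :=
  schwartz_real (fun x => complex.Re (f x)) /\
  schwartz_real (fun x => complex.Im (f x)).

Definition dot x y : R := \sum_(i < d) x ord0 i * y ord0 i.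

Definition cis (t : R) : R[i] := cos t +i* sin t.

(** Convention: [fourier f xi] is the integral of [f x * e^(- i x . xi)], so
    that [- Delta] has symbol [|xi|^2]. *)
Definition fourier f : 'rV[R]_d -> R[i] :=
  fun xi => cintegral setT (fun x => f x * cis (- dot x xi)).

Definition inv_fourier f : 'rV[R]_d -> R[i] :=
  fun x => (((2 * pi) ^+ d)^-1)%:C *
           cintegral setT (fun xi => f xi * cis (dot x xi)).

Definition fourier_multiplier (m : 'rV[R]_d -> R[i]) f : 'rV[R]_d -> R[i] :=
  inv_fourier (fun xi => m xi * fourier f xi).

Definition bessel (s : R) : ('rV[R]_d -> R[i]) -> 'rV[R]_d -> R[i] :=
  fourier_multiplier (fun xi => ((1 + dot xi xi) `^ (s / 2))%:C).

Definition cube (a : 'rV[R]_d) (l : R) : set 'rV[R]_d :=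
  [set x | forall i, a ord0 i <= x ord0 i <= a ord0 i + l].

Definition volume (Q : set 'rV[R]_d) : R := fine (lebesgue_rV R d Q).

Definition average (Q : set 'rV[R]_d) u : R[i] :=
  ((volume Q)^-1)%:C * cintegral Q u.

Definition mean_oscillation (Q : set 'rV[R]_d) u : \bar R :=
  (((volume Q)^-1)%:E *
   \int[lebesgue_rV R d]_(y in Q) (Normc.normc (u y - average Q u))%:E)%E.

Definition BMO_norm u : \bar R :=
  ereal_sup [set r | exists (a : 'rV[R]_d) (l : R),
    0 < l /\ r = mean_oscillation (cube a l) u].

(** The norm of a vector of functions is the sum of the norms of its
    components. *)
Definition grad_sup_norm f : \bar R :=
  (\sum_(i < d) cLnorm +oo (cpartial i f))%E.

End complex_functions.

(* Main.v *)
Require Import Defs.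
From HB Require Import structures.
From mathcomp Require Import all_boot all_order all_algebra.
From mathcomp Require Import complex.
From mathcomp Require Import all_classical all_reals all_analysis.
From mathcomp Require Import measurable_realfun ess_sup_inf.
From mathcomp Require Import ring lra.

Set Implicit Arguments.
Unset Strict Implicit.
Unset Printing Implicit Defensive.

Import Order.TTheory GRing.Theory Num.Theory.
Import numFieldNormedType.Exports.

Local Open Scope classical_set_scope.
Local Open Scope ring_scope.

(** To leading order the commutator is [g J^s f], and BMO does not control the sup
    norm of [g].  Let [g] be a smooth version of a truncated logarithm, a sum of
    [n] Gaussians of dyadic widths [1, 2, ..., 2^(n - 1)]: its BMO norm is bounded
    independently of [n] ([BMO_log_bump]), yet [g] is of size [n] on the unit
    cube.  Let [f] be a unit Gaussian modulated to a frequency [c] with [|c| = N],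
    called a wave below.  As [N] tends to infinity with [n] fixed:

    - [||J^s f||_p] is at most [C N^s] with [C] independent of [n] and [N]
      ([bessel_wave_decay]);
    - [f g] is a sum of waves of frequency [c], on which [J^s] acts as the
      multiplication by [N^s] up to [O(N^(s - 1))] uniformly
      ([bessel_wave_approx], [bessel_product_approx]), so [|J^s (f g)|] is at
      least a fixed multiple of [n N^s] on the unit cube, up to [O(N^(s - 1))];
    - [f J^s g] and [||J^(s-1) g||_p] do not grow with [N], and [||grad f||_oo] is
      [O(N)] ([grad_wave_bound]).

    As [s > 1], the ratio of the two sides of the inequality is at least a fixed
    multiple of [n] once [N] is large, and [n] is arbitrary.

    All the functions involved are finite sums of modulated Gaussians, so that
    their Fourier transforms are explicit.  The one-dimensional transform is found
    from the differential equation that it satisfies ([gauss1_cos_transform]), and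
    the transform in [R^d] is a tensor product of those.  The only quantities that
    are not explicit are the Bessel potentials themselves: inverse Fourier
    transforms of [(1 + |xi|^2)^(s/2)] times a Gaussian centred at [c].  Their
    decay, needed for the [L^p] norm, is obtained by a discrete form of
    integration by parts: translating by half a period of the character
    [exp (i x . xi)] changes the sign of the integral, so the integrand may be
    replaced by half its difference with its translate, repeatedly
    ([osc_half_diff]).  Iterated differences are bounded by derivatives along one
    axis, which are controlled uniformly in [c] ([sym_half_diff_bound]). *)

(** * Integration over the space of rows *)

Section integral_monotone.
Context d (T : measurableType d) (R : realType)
  (mu : {measure set T -> \bar R}).
Import HBNNSimple.

(** The integral of a nonnegative function is a supremum over the simple
    functions below it, so that its monotonicity needs no measurability. This
    lets norms be compared with explicit functions without proving that the
    Bessel potentials are measurable. *)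
Lemma ge0_le_integral_any (f g : T -> \bar R) :
  (forall x, 0 <= f x)%E -> (forall x, f x <= g x)%E ->
  (\int[mu]_x f x <= \int[mu]_x g x)%E.
Proof.
move=> f0 fg; have g0 x : (0 <= g x)%E by exact: le_trans (f0 x) (fg x).
rewrite !ge0_integralTE//; apply: le_ereal_sup => _ [h /= hf <-].
by exists h => // x /=; exact: le_trans (hf x) (fg x).
Qed.

End integral_monotone.

Section rV_integral.
Context {R : realType}.
Local Notation mu := (@lebesgue_measure R).
Local Notation L n := (lebesgue_rV R n).

Lemma measurable_rV_entry n (i : 'I_n) :
  measurable_fun setT (fun x : 'rV[R]_n => x ord0 i : R).
Proof. exact: measurable_rV_coord. Qed.

Lemma rV_cons_ord0 n (z : measurableTypeR R * 'rV[R]_n) : rV_cons z ord0 ord0 =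
  z.1.
Proof. exact: (rV_cons0 z). Qed.

Lemma rV_cons_lift n (z : measurableTypeR R * 'rV[R]_n) (j : 'I_n) :
  rV_cons z ord0 (lift ord0 j) = z.2 ord0 j.
Proof. exact: (rV_consS z). Qed.

Lemma ge0_integral_rVS n (F : 'rV[R]_n.+1 -> \bar R) :
  measurable_fun setT F -> (forall x, 0 <= F x)%E ->
  (\int[L n.+1]_x F x = \int[mu]_t \int[L n]_x F (rV_cons (t, x)))%E.
Proof.
move=> mF F0; rewrite /= /cons_measure.
rewrite (ge0_integral_pushforward (@measurable_rV_cons R n))//=.
rewrite preimage_setT fubini_tonelli1//=.
- by apply: measurableT_comp => //; exact: measurable_rV_cons.
Qed.

(** The source of every explicit integral below: Gaussians, the weights that
    dominate the Bessel potentials, and indicators of cubes are all tensor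
    products. *)
Lemma ge0_integral_rV_prod n (h : 'I_n -> R -> R) :
  (forall i, measurable_fun setT (h i)) -> (forall i t, 0 <= h i t) ->
  (\int[L n]_x (\prod_i h i (x ord0 i))%:E = \prod_i \int[mu]_t (h i t)%:E)%E.
Proof.
elim: n h => [|n IH] h mh h0.
  rewrite big_ord0; under eq_integral do rewrite big_ord0.
  rewrite /= integral_cst// mul1e. exact: diracT.
rewrite ge0_integral_rVS; last 2 first.
- apply/measurable_EFinP; apply: measurable_prod => i _.
  by apply: measurableT_comp => //; exact: measurable_rV_entry.
- by move=> x; rewrite lee_fin prodr_ge0.
have i0 : (0 <= \prod_(i < n) \int[mu]_t (h (lift ord0 i) t)%:E)%E.
  apply: (big_ind (fun y : \bar R => (0 <= y)%E)) => // [x y|i _].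
    exact: mule_ge0.
  by apply: integral_ge0 => t _; rewrite lee_fin.
rewrite big_ord_recl/= -ge0_integralZr//=; last 2 first.
- by apply/measurable_EFinP; exact: mh.
- by move=> t _; rewrite lee_fin.
apply: eq_integral => t _; rewrite -IH// -ge0_integralZl//=; last 3 first.
- apply/measurable_EFinP; apply: measurable_prod => i _.
  by apply: measurableT_comp => //; exact: measurable_rV_entry.
- by move=> x _; rewrite lee_fin prodr_ge0.
- by rewrite lee_fin.
apply: eq_integral => x _; rewrite -EFinM big_ord_recl rV_cons_ord0.
by congr ((_ * _)%:E); apply: eq_bigr => i _; rewrite rV_cons_lift.
Qed.

Lemma ge0_integral_shift (F : R -> \bar R) (v : R) :
  measurable_fun setT F -> (forall t, 0 <= F t)%E ->
  (\int[mu]_t F (t + v)%R = \int[mu]_t F t)%E.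
Proof.
move=> mF F0.
have mv : measurable_fun setT (fun t : measurableTypeR R => t + v :
  measurableTypeR R).
  exact: measurable_funD.
transitivity (\int[pushforward mu (fun t : measurableTypeR R =>
  (t + v : measurableTypeR R)%R)]_t F t)%E.
  by rewrite (ge0_integral_pushforward mv)// preimage_setT.
apply: eq_measure_integral => //= A mA _.
have := @lebesgue_measure_unique R (pushforward mu
  (fun t : measurableTypeR R => (t + v : measurableTypeR R)%R)) _ A mA.
move=> <-// _ [[a b] _ <-]; rewrite /= /pushforward.
rewrite (_ : _ @^-1` _ = `]a - v, b - v]%classic); last first.
  by apply/seteqP; split => t /=; rewrite !in_itv/= ltrBlDr lerBrDr.
rewrite !lebesgue_measure_itv/= !lte_fin ltrD2r.
by case: ifP => // _; congr (_%:E); ring.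
Qed.

Lemma Rintegral_shift (F : R -> R) (v : R) : measurable_fun setT F ->
  \int[mu]_t F (t + v) = \int[mu]_t F t.
Proof.
move=> mF; rewrite /Rintegral; congr fine.
rewrite [LHS]integralE [RHS]integralE.
have mE : measurable_fun setT (EFin \o F) by exact/measurable_EFinP.
congr (_ - _)%E.
- rewrite -(ge0_integral_shift (F := (EFin \o F)^\+ )%E v)//;
    first by apply: eq_integral => x _; rewrite !unlock.
  exact: measurable_funepos.
- rewrite -(ge0_integral_shift (F := (EFin \o F)^\- )%E v)//;
    first by apply: eq_integral => x _; rewrite !unlock.
  exact: measurable_funeneg.
Qed.

Lemma measurable_rV_shift n (v : 'rV[R]_n) :
  measurable_fun setT (fun x : 'rV[R]_n => x + v).
Proof.
apply: measurable_rVP => i; rewrite /rV_coord.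
under eq_fun do rewrite mxE.
by apply: measurable_funD => //; exact: measurable_rV_entry.
Qed.

Lemma ge0_integral_rV_shift n (F : 'rV[R]_n -> \bar R) (v : 'rV[R]_n) :
  measurable_fun setT F -> (forall t, 0 <= F t)%E ->
  (\int[L n]_x F (x + v)%R = \int[L n]_x F x)%E.
Proof.
elim: n F v => [|n IH] F v mF F0.
  by apply: eq_integral => x _; rewrite [x + v]thinmx0 [x]thinmx0.
have mFc : measurable_fun setT (fun z : measurableTypeR R * 'rV[R]_n =>
  F (rV_cons z)).
  by apply: measurableT_comp => //; exact: measurable_rV_cons.
rewrite ge0_integral_rVS//; last first.
  by apply: measurableT_comp => //; exact: measurable_rV_shift.
pose w : 'rV[R]_n := \row_j v ord0 (lift ord0 j).
have consD t (x : 'rV[R]_n) : rV_cons (t, x) + v =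
  rV_cons (t + v ord0 ord0, x + w).
  apply/rowP => i; rewrite mxE; have [j ->|->] := unliftP ord0 i.
    by rewrite !rV_cons_lift !mxE.
  by rewrite !rV_cons_ord0.
under eq_integral => t _ do under eq_integral => x _ do rewrite consD.
under eq_integral => t _.
  rewrite (IH (fun x => F (rV_cons (t + v ord0 ord0, x))))//; last first.
    exact: (measurableT_comp mFc (measurable_pair1 _)).
  over.
rewrite (ge0_integral_shift (F := fun t => \int[L n]_x F (rV_cons (t, x)))%E)//.
- by rewrite ge0_integral_rVS.
- apply: (measurable_fun_fubini_tonelli_F (fun z => F (rV_cons z))) => //.
- by move=> t; exact: integral_ge0.
Qed.

Lemma Rintegral_rV_shift n (F : 'rV[R]_n -> R) (v : 'rV[R]_n) :
  measurable_fun setT F ->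
  \int[L n]_x F (x + v) = \int[L n]_x F x.
Proof.
move=> mF; rewrite /Rintegral; congr fine.
rewrite [LHS]integralE [RHS]integralE.
have mE : measurable_fun setT (EFin \o F) by exact/measurable_EFinP.
congr (_ - _)%E.
- rewrite -(ge0_integral_rV_shift (F := (EFin \o F)^\+ )%E v)//;
  first by apply: eq_integral => x _; rewrite !unlock.
  exact: measurable_funepos.
- rewrite -(ge0_integral_rV_shift (F := (EFin \o F)^\- )%E v)//;
  first by apply: eq_integral => x _; rewrite !unlock.
  exact: measurable_funeneg.
Qed.

Lemma integrable_rV_prod n (h : 'I_n -> R -> R) :
  (forall i, mu.-integrable setT (EFin \o h i)) ->
  (L n).-integrable setT (fun x => (\prod_i h i (x ord0 i))%:E).
Proof.
move=> ih.
have mh i : measurable_fun setT (h i).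
  by apply/measurable_EFinP; exact: measurable_int (ih i).
apply/integrableP; split.
  apply/measurable_EFinP; apply: measurable_prod => i _.
  by apply: measurableT_comp => //; exact: measurable_rV_entry.
under eq_integral do rewrite abse_EFin normr_prod.
rewrite (ge0_integral_rV_prod (h := fun i t => `|h i t|))//; last first.
  by move=> i; exact: measurableT_comp.
have fi i : (\int[mu]_t `|h i t|%:E)%E \is a fin_num.
  by apply: integrable_fin_num => //; exact: (integrable_norm (ih i)).
rewrite ltey_eq; apply/orP; left.
by apply: (big_ind (fun y : \bar R => y \is a fin_num)) => //= x y fx fy;
  rewrite fin_numM.
Qed.

End rV_integral.

(** * Complex-valued integrals *)

Section complex_numbers.
Context {R : realType}.
Local Open Scope complex_scope.
Implicit Types (z w : R[i]) (a t : R).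
Import Normc.

Lemma complexP z w : complex.Re z = complex.Re w -> complex.Im z =
  complex.Im w -> z = w.
Proof. by case: z => a b; case: w => a' b' /= -> ->. Qed.

Lemma ReD z w : complex.Re (z + w) = complex.Re z + complex.Re w.
Proof. by case: z => a b; case: w. Qed.

Lemma ImD z w : complex.Im (z + w) = complex.Im z + complex.Im w.
Proof. by case: z => a b; case: w. Qed.

Lemma ReM z w : complex.Re (z * w) =
  complex.Re z * complex.Re w - complex.Im z * complex.Im w.
Proof. by case: z => a b; case: w. Qed.

Lemma ImM z w : complex.Im (z * w) =
  complex.Re z * complex.Im w + complex.Im z * complex.Re w.
Proof. by case: z => a b; case: w => a' b' /=; congr (_ + _);
  rewrite mulrC. Qed.

Lemma Re_sum (I : Type) (r : seq I) (F : I -> R[i]) :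
  complex.Re (\sum_(i <- r) F i) = \sum_(i <- r) complex.Re (F i).
Proof. by apply: (big_morph (@complex.Re R)) => //; exact: ReD. Qed.

Lemma Im_sum (I : Type) (r : seq I) (F : I -> R[i]) :
  complex.Im (\sum_(i <- r) F i) = \sum_(i <- r) complex.Im (F i).
Proof. by apply: (big_morph (@complex.Im R)) => //; exact: ImD. Qed.

Lemma realcM a b : (a * b)%:C = a%:C * b%:C :> R[i].
Proof. by apply: complexP; rewrite ?ReM ?ImM /=; ring. Qed.

Lemma realcD a b : (a + b)%:C = a%:C + b%:C :> R[i].
Proof. by apply: complexP; rewrite ?ReD ?ImD /=; ring. Qed.

Lemma realc_sum (I : Type) (r : seq I) (F : I -> R) :
  (\sum_(i <- r) F i)%:C = \sum_(i <- r) (F i)%:C :> R[i].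
Proof. by apply: (big_morph (fun x : R => x%:C)) => //; exact: realcD. Qed.

Lemma realc_prod (I : Type) (r : seq I) (F : I -> R) :
  (\prod_(i <- r) F i)%:C = \prod_(i <- r) (F i)%:C :> R[i].
Proof. by apply: (big_morph (fun x : R => x%:C)) => //; exact: realcM. Qed.

Lemma normcE z : normc z = Num.sqrt (complex.Re z ^+ 2 + complex.Im z ^+ 2).
Proof. by case: z. Qed.

Lemma normc_ge0 z : 0 <= normc z.
Proof. by rewrite normcE sqrtr_ge0. Qed.

Lemma ler_Re_normc z : `|complex.Re z| <= normc z.
Proof. by rewrite normcE -sqrtr_sqr ler_wsqrtr// lerDl sqr_ge0. Qed.

Lemma ler_Im_normc z : `|complex.Im z| <= normc z.
Proof. by rewrite normcE -sqrtr_sqr ler_wsqrtr// lerDr sqr_ge0. Qed.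

Lemma normc_leD z : normc z <= `|complex.Re z| + `|complex.Im z|.
Proof.
rewrite normcE -[leRHS]ger0_norm ?addr_ge0// -sqrtr_sqr ler_wsqrtr//.
rewrite sqrrD !real_normK ?num_real//.
by rewrite -addrA [_ *+ 2 + _]addrC addrA lerDl mulrn_wge0// mulr_ge0.
Qed.

Lemma normc_real a : normc (a%:C : R[i]) = `|a|.
Proof. by rewrite normcE /= expr0n addr0 sqrtr_sqr. Qed.

Lemma ler_normcD z w : normc (z + w) <= normc z + normc w.
Proof. by have := ler_normD z w; rewrite !normc_def -realcD lecR !normcE. Qed.

Lemma ler_normc_sum (I : Type) (r : seq I) (F : I -> R[i]) :
  normc (\sum_(i <- r) F i) <= \sum_(i <- r) normc (F i).
Proof.
elim/big_ind2: _ => [|z a w b za wb|//]; first by rewrite normcE /=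
  expr0n addr0 sqrtr0.
by apply: le_trans (ler_normcD _ _) _; exact: lerD.
Qed.

Lemma normcN z : normc (- z) = normc z.
Proof. by case: z => a b /=; rewrite !sqrrN. Qed.

Lemma ler_normcB z w : normc z - normc w <= normc (z - w).
Proof. by rewrite lerBlDr; apply: le_trans (ler_normcD _ _); rewrite subrK. Qed.

Lemma cisD a b : cis (a + b) = cis a * cis b :> R[i].
Proof.
apply: complexP; rewrite ?ReM ?ImM /cis /=; first exact: cosD.
by rewrite sinD addrC.
Qed.

Lemma cis0 : cis 0 = 1 :> R[i].
Proof. by rewrite /cis cos0 sin0. Qed.

Lemma normc_cis a : normc (cis a : R[i]) = 1.
Proof. by rewrite normcE /cis /= cos2Dsin2 sqrtr1. Qed.

Lemma cis_sum (I : Type) (r : seq I) (F : I -> R) :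
  cis (\sum_(i <- r) F i) = \prod_(i <- r) cis (F i) :> R[i].
Proof. by apply: (big_morph (@cis R)); [exact: cisD|exact: cis0]. Qed.

End complex_numbers.

Section complex_integral.
Context d (T : measurableType d) (R : realType)
  (mu : {measure set T -> \bar R}).
Local Open Scope complex_scope.
Import Normc.
Implicit Types F G : T -> R[i].

(** Over an arbitrary measure, so that the integral over [R^d], the integral
    over the line and the integral over a product are instances of one
    notion. *)
Definition cint F : R[i] :=
  (\int[mu]_x complex.Re (F x)) +i* (\int[mu]_x complex.Im (F x)).

Definition cmeasurable F :=
  measurable_fun setT (fun x => complex.Re (F x)) /\
  measurable_fun setT (fun x => complex.Im (F x)).

Definition cintegrable F :=
  mu.-integrable setT (EFin \o (fun x => complex.Re (F x))) /\
  mu.-integrable setT (EFin \o (fun x => complex.Im (F x))).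

Lemma cmeasurableM F G : cmeasurable F -> cmeasurable G ->
  cmeasurable (fun x => F x * G x).
Proof.
move=> [rF iF] [rG iG]; split.
  under eq_fun do rewrite ReM.
  by apply: measurable_funB; apply: measurable_funM.
under eq_fun do rewrite ImM.
by apply: measurable_funD; apply: measurable_funM.
Qed.

Lemma cmeasurable_real (f : T -> R) : measurable_fun setT f ->
  cmeasurable (fun x => (f x)%:C).
Proof. by move=> mf; split => //=; exact: measurable_cst. Qed.

Lemma cmeasurable_cis (f : T -> R) : measurable_fun setT f ->
  cmeasurable (fun x => cis (f x)).
Proof.
move=> mf; split => /=.
  apply: (measurableT_comp (f := @cos R)) mf.
  by apply: continuous_measurable_fun; exact: continuous_cos.
apply: (measurableT_comp (f := @sin R)) mf.
by apply: continuous_measurable_fun; exact: continuous_sin.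
Qed.

Lemma cintegrable_measurable F : cintegrable F -> cmeasurable F.
Proof.
by move=> [rF iF]; split; apply/measurable_EFinP;
  [exact: measurable_int rF|exact: measurable_int iF].
Qed.

Lemma cintegrable_le F (g : T -> R) : cmeasurable F ->
  mu.-integrable setT (EFin \o g) -> (forall x, normc (F x) <= g x) ->
  cintegrable F.
Proof.
move=> [rF iF] ig Fg; split; apply: le_integrable ig => //=.
- exact/measurable_EFinP.
- move=> x _; rewrite lee_fin (le_trans (ler_Re_normc _))//.
  by rewrite (le_trans (Fg x))// ler_norm.
- exact/measurable_EFinP.
- move=> x _; rewrite lee_fin (le_trans (ler_Im_normc _))//.
  by rewrite (le_trans (Fg x))// ler_norm.
Qed.

Lemma eq_cint F G : F =1 G -> cint F = cint G.
Proof. by move=> /funext ->. Qed.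

Lemma cintD F G : cintegrable F -> cintegrable G ->
  cint (fun x => F x + G x) = cint F + cint G.
Proof.
move=> [rF iF] [rG iG]; apply: complexP; rewrite ?ReD ?ImD /=.
  by rewrite -RintegralD//; apply: eq_Rintegral => x _; rewrite ReD.
by rewrite -RintegralD//; apply: eq_Rintegral => x _; rewrite ImD.
Qed.

Lemma cintegrableD F G : cintegrable F -> cintegrable G ->
  cintegrable (fun x => F x + G x).
Proof.
move=> [rF iF] [rG iG]; split.
  by apply: eq_integrable (integrableD measurableT rF rG) => // x _ /=;
    rewrite ReD EFinD.
by apply: eq_integrable (integrableD measurableT iF iG) => // x _ /=;
  rewrite ImD EFinD.
Qed.

Lemma cintegrableZ (c : R[i]) F : cintegrable F ->
  cintegrable (fun x => c * F x).
Proof.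
move=> [rF iF]; split.
  have := integrableD measurableT (integrableZl measurableT (complex.Re c) rF)
    (integrableZl measurableT (- complex.Im c) iF).
  by apply: eq_integrable => // x _ /=; rewrite ReM EFinD !EFinM EFinN mulNe
    -EFinM.
have := integrableD measurableT (integrableZl measurableT (complex.Re c) iF)
  (integrableZl measurableT (complex.Im c) rF).
by apply: eq_integrable => // x _ /=; rewrite ImM.
Qed.

Lemma cintZ (c : R[i]) F : cintegrable F -> cint (fun x => c * F x) =
  c * cint F.
Proof.
move=> [rF iF].
have sub (u v : T -> R) (a b : R) : mu.-integrable setT (EFin \o u) ->
    mu.-integrable setT (EFin \o v) ->
    \int[mu]_x (a * u x + b * v x) = a * (\int[mu]_x u x)
      + b * (\int[mu]_x v x).
  move=> iu iv; rewrite -!RintegralZl// -RintegralD//.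
    exact: (integrableZl _ a iu).
  exact: (integrableZl _ b iv).
apply: complexP; rewrite ?ReM ?ImM /=.
  rewrite -mulNr -sub//; apply: eq_Rintegral => x _.
  by rewrite ReM mulNr.
by rewrite -sub//; apply: eq_Rintegral => x _; rewrite ImM.
Qed.

Lemma cint0 : cint (fun=> 0) = 0.
Proof. by rewrite /cint /Rintegral !integral0_eq. Qed.

Lemma cintegrable0 : cintegrable (fun=> 0).
Proof. by split; exact: integrable0. Qed.

Lemma cint_sum n (F : 'I_n -> T -> R[i]) : (forall i, cintegrable (F i)) ->
  cintegrable (fun x => \sum_i F i x) /\
  cint (fun x => \sum_i F i x) = \sum_i cint (F i).
Proof.
elim: n F => [|n IH] F iF.
  have -> : (fun x => \sum_i F i x) = (fun=> 0) by apply/funext => x;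
    rewrite big_ord0.
  by rewrite big_ord0 cint0; split => //; exact: cintegrable0.
have -> : (fun x => \sum_i F i x) =
    (fun x => F ord0 x + \sum_i F (lift ord0 i) x).
  by apply/funext => x; rewrite big_ord_recl.
have [i1 e1] := IH (fun i => F (lift ord0 i)) (fun i => iF _).
split; first exact: cintegrableD.
by rewrite cintD// e1 big_ord_recl.
Qed.

(** The constant [2] is not sharp; it spares the rotation of [F] by the phase of
    its integral. *)
Lemma normc_cint_le F (g : T -> R) : cintegrable F ->
  mu.-integrable setT (EFin \o g) -> (forall x, normc (F x) <= g x) ->
  normc (cint F) <= 2 * \int[mu]_x g x.
Proof.
move=> [rF iF] ig Fg; apply: le_trans (normc_leD _) _.
rewrite mulr_natl mulr2n /=; apply: lerD.
  apply: le_trans (le_normr_Rintegral _ _) _ => //.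
  apply: le_Rintegral => //; first exact: integrable_norm rF.
  by move=> x _; exact: le_trans (ler_Re_normc _) (Fg x).
apply: le_trans (le_normr_Rintegral _ _) _ => //.
apply: le_Rintegral => //; first exact: integrable_norm iF.
by move=> x _; exact: le_trans (ler_Im_normc _) (Fg x).
Qed.

End complex_integral.

Section complex_product.
Context d1 d2 (T1 : measurableType d1) (T2 : measurableType d2) (R : realType).
Variables (m1 : {sigma_finite_measure set T1 -> \bar R})
  (m2 : {sigma_finite_measure set T2 -> \bar R}).
Local Open Scope complex_scope.

Lemma integrable_prod_mul (f : T1 -> R) (g : T2 -> R) :
  m1.-integrable setT (EFin \o f) -> m2.-integrable setT (EFin \o g) ->
  (m1 \x m2)%E.-integrable setT (fun z => (f z.1 * g z.2)%:E).
Proof.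
move=> If Ig.
have mf : measurable_fun setT f by apply/measurable_EFinP;
  exact: measurable_int If.
have mg : measurable_fun setT g by apply/measurable_EFinP;
  exact: measurable_int Ig.
apply/integrable12ltyP => /=.
  apply/measurable_EFinP; apply: measurable_funM.
    exact: measurableT_comp.
  exact: measurableT_comp.
have fg : (\int[m2]_y `|g y|%:E)%E \is a fin_num.
  by apply: integrable_fin_num => //; exact: (integrable_norm Ig).
have ff : (\int[m1]_y `|f y|%:E)%E \is a fin_num.
  by apply: integrable_fin_num => //; exact: (integrable_norm If).
under eq_integral => x _.
  under eq_integral do rewrite normrM EFinM.
  rewrite ge0_integralZl//=; last by apply/measurable_EFinP;
    exact: measurableT_comp.
  over.
rewrite ge0_integralZr//=.
- by rewrite ltey_eq fin_numM.
- by apply/measurable_EFinP; exact: measurableT_comp.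
- by apply: integral_ge0 => y _; rewrite lee_fin.
Qed.

Lemma Rintegral_prod_mul (f : T1 -> R) (g : T2 -> R) :
  m1.-integrable setT (EFin \o f) -> m2.-integrable setT (EFin \o g) ->
  \int[(m1 \x m2)%E]_z (f z.1 * g z.2) = (\int[m1]_x f x) * (\int[m2]_y g y).
Proof.
move=> If Ig.
have fg : (\int[m2]_y (g y)%:E)%E \is a fin_num by exact: integrable_fin_num.
have ff : (\int[m1]_y (f y)%:E)%E \is a fin_num by exact: integrable_fin_num.
rewrite /Rintegral -(integral12_prod_meas1 (integrable_prod_mul If Ig))
  /fubini_F/=.
under eq_integral => x _.
  under eq_integral do rewrite EFinM.
  rewrite integralZl//=.
  rewrite -(fineK fg).
  over.
by rewrite integralZr//= fineM.
Qed.

Lemma cint_prod_mul (F : T1 -> R[i]) (G : T2 -> R[i]) :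
  cintegrable m1 F -> cintegrable m2 G ->
  cintegrable (m1 \x m2)%E (fun z => F z.1 * G z.2) /\
  cint (m1 \x m2)%E (fun z => F z.1 * G z.2) = cint m1 F * cint m2 G.
Proof.
move=> [rF iF] [rG iG].
have rr := integrable_prod_mul rF rG.
have ri := integrable_prod_mul rF iG.
have ir := integrable_prod_mul iF rG.
have ii := integrable_prod_mul iF iG.
split.
  split.
    by apply: eq_integrable (integrableB measurableT rr ii) => // z _ /=;
      rewrite ReM EFinB.
  by apply: eq_integrable (integrableD measurableT ri ir) => // z _ /=;
    rewrite ImM EFinD.
apply: complexP; rewrite ?ReM ?ImM /=.
  rewrite -!Rintegral_prod_mul// -RintegralB//.
  by apply: eq_Rintegral => z _; rewrite ReM.
rewrite -!Rintegral_prod_mul// -RintegralD//.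
by apply: eq_Rintegral => z _; rewrite ImM.
Qed.

End complex_product.

Section complex_rV.
Context {R : realType}.
Local Notation mu := (@lebesgue_measure R).
Local Notation L n := (lebesgue_rV R n).
Local Open Scope complex_scope.

(** Integrability is to be proved on the product, where the factors of a tensor
    product separate. *)
Lemma cint_rVS n (F : 'rV[R]_n.+1 -> R[i]) :
  cmeasurable F ->
  cintegrable (mu \x L n)%E (fun z => F (rV_cons z)) ->
  cintegrable (L n.+1) F /\
  cint (L n.+1) F = cint (mu \x L n)%E (fun z => F (rV_cons z)).
Proof.
move=> [mr mi] [rF iF]; split.
  split; apply: integrable_pushforward => //=; try exact: measurable_rV_cons;
    exact/measurable_EFinP.
by rewrite /cint /Rintegral /= /cons_measure; congr (_ +i* _); congr fine;
  rewrite (integral_pushforward (@measurable_rV_cons R n))//;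
  exact/measurable_EFinP.
Qed.

Lemma cmeasurable_rV_prod n (h : 'I_n -> R -> R[i]) :
  (forall i, cmeasurable (h i)) ->
  cmeasurable (fun x : 'rV[R]_n => \prod_i h i (x ord0 i)).
Proof.
move=> mh.
have H (s : seq 'I_n) : cmeasurable (fun x : 'rV[R]_n => \prod_(i <- s)
  h i (x ord0 i)).
  elim: s => [|j s IH].
    by split; under eq_fun do rewrite big_nil /=; exact: measurable_cst.
  have -> : (fun x : 'rV[R]_n => \prod_(i <- j :: s) h i (x ord0 i)) =
      (fun x => h j (x ord0 j) * \prod_(i <- s) h i (x ord0 i)).
    by apply/funext => x; rewrite big_cons.
  apply: cmeasurableM => //; have [mr mi] := mh j; split.
    by apply: (measurableT_comp mr); exact: measurable_rV_entry.
  by apply: (measurableT_comp mi); exact: measurable_rV_entry.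
exact: H.
Qed.

Lemma cint_rV_prod n (h : 'I_n -> R -> R[i]) :
  (forall i, cintegrable mu (h i)) ->
  cintegrable (L n) (fun x => \prod_i h i (x ord0 i)) /\
  cint (L n) (fun x => \prod_i h i (x ord0 i)) = \prod_i cint mu (h i).
Proof.
elim: n h => [|n IH] h ih.
  have -> : (fun x : 'rV[R]_0 => \prod_i h i (x ord0 i)) = (fun=> 1).
    by apply/funext => x; rewrite big_ord0.
  have i1 : (L 0).-integrable setT (EFin \o (fun=> 1 : R)).
    by apply: finite_measure_integrable_cst.
  split; first by split => //; exact: integrable0.
  rewrite big_ord0; apply: complexP; rewrite /= /Rintegral.
    by rewrite integral_cst//= indicT mul1r.
  by rewrite integral0_eq.
have [ti te] := IH (fun i => h (lift ord0 i)) (fun i => ih _).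
have [pi pe] := cint_prod_mul (ih ord0) ti.
have E : (fun z : measurableTypeR R * 'rV[R]_n =>
  \prod_i h i (rV_cons z ord0 i)) =
    (fun z => h ord0 z.1 * \prod_i h (lift ord0 i) (z.2 ord0 i)).
  apply/funext => z; rewrite big_ord_recl rV_cons_ord0; congr (_ * _).
  by apply: eq_bigr => i _; rewrite rV_cons_lift.
have mP : cmeasurable (fun x : 'rV[R]_n.+1 => \prod_i h i (x ord0 i)).
  by apply: cmeasurable_rV_prod => i; exact: cintegrable_measurable (ih i).
have iP : cintegrable (mu \x L n)%E
    (fun z : measurableTypeR R * 'rV[R]_n => \prod_i h i (rV_cons z ord0 i)).
  by rewrite E.
have [i1 ->] := cint_rVS mP iP.
by split => //; rewrite E big_ord_recl -te -pe.
Qed.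

End complex_rV.

(** * One-variable calculus and Gaussians *)

Section one_variable_calculus.
Context {R : realType}.
Implicit Types (f g : R -> R) (x t a b : R).

(** A predicate under which the rules of differentiation apply to functions that
    are written pointwise. *)
Definition has_deriv f x df := is_derive (x : R^o) (1 : R^o) (f : R^o -> R^o)
  df.

Lemma has_deriv_eq f x df df' : has_deriv f x df -> df = df' ->
  has_deriv f x df'.
Proof. by move=> H <-. Qed.

Lemma has_deriv_cst a x : has_deriv (fun=> a) x 0.
Proof. exact: is_derive_cst. Qed.

Lemma has_deriv_id x : has_deriv (fun t => t) x 1.
Proof. exact: is_derive_id. Qed.

Lemma has_derivD f g x df dg : has_deriv f x df -> has_deriv g x dg ->
  has_deriv (fun t => f t + g t) x (df + dg).
Proof. exact: is_deriveD. Qed.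

Lemma has_derivB f g x df dg : has_deriv f x df -> has_deriv g x dg ->
  has_deriv (fun t => f t - g t) x (df - dg).
Proof. exact: is_deriveB. Qed.

Lemma has_derivM f g x df dg : has_deriv f x df -> has_deriv g x dg ->
  has_deriv (fun t => f t * g t) x (f x * dg + g x * df).
Proof. exact: is_deriveM. Qed.

Lemma has_derivZ f a x df : has_deriv f x df -> has_deriv (fun t => a * f t)
  x (a * df).
Proof. exact: (@is_deriveZ _ _ _ f a). Qed.

Lemma has_derivN f x df : has_deriv f x df -> has_deriv (fun t => - f t)
  x (- df).
Proof. exact: is_deriveN. Qed.

Lemma has_deriv_comp f g x df dg : has_deriv f (g x) df -> has_deriv g x dg ->
  has_deriv (fun t => f (g t)) x (df * dg).
Proof. exact: is_derive1_comp. Qed.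

Lemma has_deriv_expR f x df : has_deriv f x df ->
  has_deriv (fun t => expR (f t)) x (expR (f x) * df).
Proof. by apply: has_deriv_comp; exact: is_derive_expR. Qed.

Lemma has_deriv_cos f x df : has_deriv f x df ->
  has_deriv (fun t => cos (f t)) x (- sin (f x) * df).
Proof. by apply: has_deriv_comp; exact: is_derive_cos. Qed.

Lemma has_deriv_sin f x df : has_deriv f x df ->
  has_deriv (fun t => sin (f t)) x (cos (f x) * df).
Proof. by apply: has_deriv_comp; exact: is_derive_sin. Qed.

Lemma has_deriv_inv f x df : f x != 0 -> has_deriv f x df ->
  has_deriv (fun t => (f t)^-1) x (- (f x) ^- 2 * df).
Proof.
by move=> f0 H; exact: is_deriveV.
Qed.

Lemma has_deriv_powR f x df a : 0 < f x -> has_deriv f x df ->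
  has_deriv (fun t => f t `^ a) x (a * f x `^ (a - 1) * df).
Proof. by move=> f0; apply: (has_deriv_comp (f := fun y => y `^ a));
  exact: is_derive1_powR. Qed.

Lemma has_deriv_sqrB b x : has_deriv (fun t => (t - b) ^+ 2) x (2 * (x - b)).
Proof.
have H : has_deriv (fun t => t - b) x (1 - 0).
  by apply: has_derivB; [exact: has_deriv_id|exact: has_deriv_cst].
by apply: has_deriv_eq (has_derivM H H) _; ring.
Qed.

Lemma has_deriv_continuous f x df : has_deriv f x df -> {for x, continuous f}.
Proof. by move=> [H _]; apply/differentiable_continuous/derivable1_diffP. Qed.

Lemma continuous_measurableR f : continuous f -> measurable_fun setT f.
Proof. by move=> cf; exact: continuous_measurable_fun. Qed.

Lemma has_deriv_measurable f (df : R -> R) : (forall x, has_deriv f x (df x)) ->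
  measurable_fun setT f.
Proof. by move=> H; apply: continuous_measurableR => x;
  exact: has_deriv_continuous (H x). Qed.

End one_variable_calculus.

Section gaussian.
Context {R : realType}.
Local Notation mu := (@lebesgue_measure R).
Implicit Types (b c x t v : R).

Definition gauss1 b c t : R := expR (- (b * (t - c) ^+ 2)).

Lemma gauss1_gt0 b c t : 0 < gauss1 b c t.
Proof. exact: expR_gt0. Qed.

Lemma gauss1_le1 b c t : 0 <= b -> gauss1 b c t <= 1.
Proof.
by move=> b0; rewrite -expR0 ler_expR oppr_le0 mulr_ge0// sqr_ge0.
Qed.

Lemma has_deriv_gauss1 b c t :
  has_deriv (gauss1 b c) t (gauss1 b c t * (- (b * (2 * (t - c))))).
Proof.
apply: has_deriv_expR; apply: has_derivN; apply: has_derivZ.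
exact: has_deriv_sqrB.
Qed.

Lemma measurable_gauss1 b c : measurable_fun setT (gauss1 b c).
Proof. exact: has_deriv_measurable (has_deriv_gauss1 b c). Qed.

Lemma gauss1_normal b c (b0 : 0 < b) :
  gauss1 b c = (fun t => Num.sqrt (pi / b) *
    normal_pdf c (Num.sqrt (2 * b)^-1) t).
Proof.
have s0 : Num.sqrt (2 * b)^-1 != 0 :> R.
  by rewrite gt_eqF// sqrtr_gt0 invr_gt0 mulr_gt0.
have s2 : Num.sqrt (2 * b)^-1 ^+ 2 = (2 * b)^-1 :> R.
  by rewrite sqr_sqrtr// invr_ge0 mulr_ge0// ltW.
apply/funext => t; rewrite normal_pdfE// /normal_peak /normal_fun s2.
have -> : (2 * b)^-1 * pi *+ 2 = pi / b :> R.
  by rewrite -mulr_natr; field; rewrite gt_eqF.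
rewrite mulrA divff ?mul1r; last by rewrite gt_eqF// sqrtr_gt0 divr_gt0//
  pi_gt0.
by rewrite /gauss1; congr expR; rewrite -mulr_natr; field; rewrite gt_eqF.
Qed.

Lemma integrable_gauss1 b c : 0 < b -> mu.-integrable setT (EFin \o gauss1 b c).
Proof.
move=> b0; rewrite gauss1_normal//.
exact: (integrableZl _ _ (integrable_normal_pdf _ _)).
Qed.

Lemma Rintegral_gauss1 b c : 0 < b -> \int[mu]_t gauss1 b c t =
  Num.sqrt (pi / b).
Proof.
move=> b0; rewrite gauss1_normal// RintegralZl//;
  last exact: integrable_normal_pdf.
by rewrite /Rintegral integral_normal_pdf mulr1.
Qed.

Lemma integral_gauss1 b c : 0 < b ->
  (\int[mu]_t (gauss1 b c t)%:E)%E = (Num.sqrt (pi / b))%:E.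
Proof.
move=> b0; rewrite -(Rintegral_gauss1 c b0) /Rintegral fineK//.
by apply: integrable_fin_num => //; exact: integrable_gauss1.
Qed.

(** Half of the exponent pays for a factor [`|t - c|]. *)
Lemma gauss1_absorb b c t : 0 < b ->
  `|t - c| * gauss1 b c t <= (1 + 2 / b) * gauss1 (b / 2) c t.
Proof.
move=> b0; rewrite /gauss1; set y := t - c.
have -> : - (b * y ^+ 2) = - (b / 2 * y ^+ 2) + - (b / 2 * y ^+ 2) by field.
rewrite expRD mulrA ler_wpM2r ?expR_ge0//.
rewrite -ler_pdivlMr ?expR_gt0// -expRN opprK.
have h1 := expR_ge1Dx (b / 2 * y ^+ 2).
apply: (@le_trans _ _ ((1 + 2 / b) * (1 + b / 2 * y ^+ 2))); last first.
  by rewrite ler_wpM2l// addr_ge0// divr_ge0// ltW.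
have y2 : `|y| <= 1 + y ^+ 2.
  rewrite -(real_normK (num_real y)); have := normr_ge0 y; move: `|y| => z z0.
  by rewrite -subr_ge0; have := sqr_ge0 (z - 1); nra.
apply: (le_trans y2).
have -> : (1 + 2 / b) * (1 + b / 2 * y ^+ 2) =
  1 + y ^+ 2 + (2 / b + b / 2 * y ^+ 2).
  by field; rewrite gt_eqF.
rewrite lerDl; apply: addr_ge0; first by rewrite divr_ge0// ltW.
by rewrite mulr_ge0 ?sqr_ge0// divr_ge0// ltW.
Qed.

Lemma gauss1_shift b c t v : 0 < b -> `|v| <= 1 ->
  gauss1 b c (t + v) <= expR b * gauss1 (b / 2) c t.
Proof.
move=> b0 v1; rewrite /gauss1 -expRD ler_expR.
have v2 : v ^+ 2 <= 1 by rewrite -(real_normK (num_real v)) expr_le1.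
have := mulr_ge0 (ltW b0) (sqr_ge0 (t - c + 2 * v)).
by have := ler_wpM2l (ltW b0) v2; nra.
Qed.

(** A total derivative has integral zero: the integral of [f (t + v)] does not
    depend on [v], and may be differentiated in [v] under the integral. *)
Lemma Rintegral_deriv_eq0 (f f' G : R -> R) :
  (forall t, has_deriv f t (f' t)) ->
  mu.-integrable setT (EFin \o f) ->
  mu.-integrable setT (EFin \o G) -> (forall t, 0 <= G t) ->
  (forall v t, `|v| <= 1 -> `|f' (t + v)| <= G t) ->
  \int[mu]_t f' t = 0.
Proof.
move=> df intf intG G0 fG.
have mf : measurable_fun setT f by exact: has_deriv_measurable df.
pose F (v : R) := fun t : measurableTypeR R => f (t + v).
have mF v : measurable_fun setT (F v).
  by apply: measurableT_comp => //; exact: measurable_funD.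
have intF v : mu.-integrable setT (EFin \o F v).
  apply/integrableP; split; first exact/measurable_EFinP.
  rewrite (ge0_integral_shift (F := fun t => `|f t|%:E))//.
    by have /integrableP[] := intf.
  by apply/measurable_EFinP; exact: measurableT_comp.
have dF v t : has_deriv (F ^~ t) v (f' (t + v)).
  have H : has_deriv (fun v : R => t + v) v (0 + 1).
    by apply: has_derivD; [exact: has_deriv_cst|exact: has_deriv_id].
  by apply: has_deriv_eq (has_deriv_comp (df _) H) _; rewrite add0r mulr1.
have pF v t : partial1of2 F v t = f' (t + v).
  by rewrite partial1of2E; have [_ ->] := dF v t.
have I0 : `]-1, 1[%classic (0 : R) by rewrite /= in_itv/= ltr01 ltrN10.
have dF' v (t : measurableTypeR R) (_ : `]-1, 1[%classic v)
    (_ : [set: measurableTypeR R] t) : derivable (F ^~ t) v 1.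
  by have [] := dF v t.
have GF v (t : measurableTypeR R) (vI : `]-1, 1[%classic v)
    (_ : [set: measurableTypeR R] t) : `|partial1of2 F v t| <= G t.
  rewrite pF; apply: fG.
  by move: vI; rewrite /= in_itv/= ler_norml => /andP[/ltW -> /ltW ->].
have : derive1 (fun v => \int[mu]_t F v t) 0 = \int[mu]_t f' t.
  rewrite (differentiation_under_integral (@measurableT _ (measurableTypeR R))
    I0 (fun v _ => intF v) dF' G0 intG GF).
  by apply: eq_Rintegral => t _; rewrite pF addr0.
move=> <-.
have -> : (fun v => \int[mu]_t F v t) = cst (\int[mu]_t f t).
  by apply/funext => v /=; exact: Rintegral_shift.
by rewrite derive1E; have [] := is_derive_cst (\int[mu]_t f t : R^o) (0 : R^o)
  (1 : R^o).
Qed.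

End gaussian.

(** * The Fourier transform of a modulated Gaussian *)

Section gaussian_fourier.
Context {R : realType}.
Local Notation mu := (@lebesgue_measure R).
Implicit Types (b c x t v : R).

Lemma has_deriv_shiftM b c x t : has_deriv (fun t => x * (t - c) + b) t x.
Proof.
have H : has_deriv (fun t => x * (t - c) + b) t (x * (1 - 0) + 0).
  apply: has_derivD; last exact: has_deriv_cst.
  by apply: has_derivZ; apply: has_derivB;
    [exact: has_deriv_id|exact: has_deriv_cst].
by apply: has_deriv_eq H _; cbv beta; ring.
Qed.

Lemma ler_norm_sin (x : R) : `|sin x| <= 1.
Proof. by rewrite ler_norml sin_geN1 sin_le1. Qed.

Lemma ler_norm_cos (x : R) : `|cos x| <= 1.
Proof. by rewrite ler_norml cos_geN1 cos_le1. Qed.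

Lemma measurable_cosM (th c x : R) : measurable_fun setT
  (fun t : R => cos (x * (t - c) + th)).
Proof.
apply: (has_deriv_measurable (df := fun t => - sin (x * (t - c) + th) * x)) =>
  t.
exact: has_deriv_cos (has_deriv_shiftM _ _ _ _).
Qed.

Lemma measurable_sinM (th c x : R) : measurable_fun setT
  (fun t : R => sin (x * (t - c) + th)).
Proof.
apply: (has_deriv_measurable (df := fun t => cos (x * (t - c) + th) * x)) => t.
exact: has_deriv_sin (has_deriv_shiftM _ _ _ _).
Qed.

Lemma integrable_gauss1_cos b c x th : 0 < b ->
  mu.-integrable setT (EFin \o (fun t =>
    gauss1 b c t * cos (x * (t - c) + th))).
Proof.
move=> b0; apply: le_integrable (integrable_gauss1 c b0) => //.
  apply/measurable_EFinP; apply: measurable_funM;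
    first exact: measurable_gauss1.
  exact: measurable_cosM.
move=> t _ /=; rewrite lee_fin normrM ler_piMr//; exact: ler_norm_cos.
Qed.

Lemma integrable_gauss1_sin b c x th : 0 < b ->
  mu.-integrable setT (EFin \o (fun t =>
    gauss1 b c t * sin (x * (t - c) + th))).
Proof.
move=> b0; apply: le_integrable (integrable_gauss1 c b0) => //.
  apply/measurable_EFinP; apply: measurable_funM;
    first exact: measurable_gauss1.
  exact: measurable_sinM.
move=> t _ /=; rewrite lee_fin normrM ler_piMr//; exact: ler_norm_sin.
Qed.

Lemma gauss1_absorbM b c t y : 0 < b -> `|y| <= 1 ->
  `|(t - c) * gauss1 b c t * y| <= (1 + 2 / b) * gauss1 (b / 2) c t.
Proof.
move=> b0 y1; rewrite normrM normrM (ger0_norm (ltW (gauss1_gt0 _ _ _))).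
apply: le_trans (gauss1_absorb c t b0).
by rewrite ler_piMr// mulr_ge0// ltW// gauss1_gt0.
Qed.

Lemma integrable_gauss1_linear_sin b c x th : 0 < b ->
  mu.-integrable setT
    (EFin \o (fun t => (t - c) * gauss1 b c t * sin (x * (t - c) + th))).
Proof.
move=> b0; have b20 : 0 < b / 2 by rewrite divr_gt0.
apply: le_integrable (integrableZl measurableT (1 + 2 / b)
  (integrable_gauss1 c b20)) => //.
  apply/measurable_EFinP; apply: measurable_funM; last exact: measurable_sinM.
  by apply: measurable_funM; [exact: measurable_funB|exact: measurable_gauss1].
move=> t _ /=; rewrite lee_fin.
apply: le_trans (gauss1_absorbM c t b0 (ler_norm_sin _)) _; exact: ler_norm.
Qed.

(** Integrating the derivative of [gauss1 b c t * sin (x * (t - c) + th)]. *)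
Lemma gauss1_by_parts b c x th : 0 < b ->
  \int[mu]_t ((t - c) * gauss1 b c t * sin (x * (t - c) + th)) =
  x / (2 * b) * \int[mu]_t (gauss1 b c t * cos (x * (t - c) + th)).
Proof.
move=> b0; have b20 : 0 < b / 2 by rewrite divr_gt0.
have b40 : 0 < b / 2 / 2 by rewrite divr_gt0.
pose G t := (2 * b * (1 + 2 / b) * expR (b / 2)) * gauss1 (b / 2 / 2) c t +
  (`|x| * expR b) * gauss1 (b / 2) c t.
have K0 : 0 <= 2 * b * (1 + 2 / b).
  by rewrite mulr_ge0 ?addr_ge0 ?mulr_ge0 ?invr_ge0// ltW.
suff : \int[mu]_t (x * (gauss1 b c t * cos (x * (t - c) + th)) +
     (- (2 * b)) * ((t - c) * gauss1 b c t * sin (x * (t - c) + th))) = 0.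
  rewrite RintegralD//; last 2 first.
  - exact: (integrableZl measurableT x (integrable_gauss1_cos c x th b0)).
  - exact: (integrableZl measurableT (- (2 * b))
    (integrable_gauss1_linear_sin c x th b0)).
  rewrite !RintegralZl//; last 2 first.
  - exact: integrable_gauss1_linear_sin.
  - exact: integrable_gauss1_cos.
  move=> /eqP; rewrite mulNr subr_eq0 => /eqP E.
  apply: (@mulfI _ (2 * b)); first by rewrite gt_eqF// mulr_gt0.
  by rewrite -E; field; rewrite gt_eqF.
apply: (@Rintegral_deriv_eq0 R (fun t => gauss1 b c t * sin (x * (t - c) + th))
  _ G).
- move=> t; apply: has_deriv_eq.
    apply: has_derivM; first exact: has_deriv_gauss1.
    exact: has_deriv_sin (has_deriv_shiftM _ _ _ _).
  by cbv beta; ring.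
- exact: integrable_gauss1_sin.
- apply: eq_integrable (integrableD measurableT
    (integrableZl measurableT (2 * b * (1 + 2 / b) * expR (b / 2))
      (integrable_gauss1 c b40))
    (integrableZl measurableT (`|x| * expR b) (integrable_gauss1 c b20))) => //.
- move=> t; rewrite /G; apply: addr_ge0; apply: mulr_ge0;
    rewrite ?(ltW (gauss1_gt0 _ _ _))// mulr_ge0// expR_ge0//.
- move=> v t v1; rewrite /G addrC; apply: le_trans (ler_normD _ _) _.
  apply: lerD.
    have B0 : 0 <= 2 * b by rewrite mulr_ge0// ltW.
    rewrite normrM normrN (ger0_norm B0).
    apply: (@le_trans _ _ (2 * b * ((1 + 2 / b) * gauss1 (b / 2) c (t + v)))).
      by rewrite ler_wpM2l//; exact: gauss1_absorbM (ler_norm_sin _).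
    by rewrite [leLHS]mulrA -[leRHS]mulrA ler_wpM2l//; exact: gauss1_shift.
  rewrite -mulrA normrM ler_wpM2l// normrM (ger0_norm (ltW (gauss1_gt0 _ _ _))).
  apply: le_trans (gauss1_shift c t b0 v1).
  by rewrite ler_piMr ?ler_norm_cos// ltW// gauss1_gt0.
Qed.

(** As a function [u] of [x] the integral solves [u' = - (x / (2 * b)) * u]. *)
Lemma gauss1_cos_transform b c x th : 0 < b ->
  \int[mu]_t (gauss1 b c t * cos (x * (t - c) + th)) =
  Num.sqrt (pi / b) * expR (- (x ^+ 2 / (4 * b))) * cos th.
Proof.
move=> b0; have b20 : 0 < b / 2 by rewrite divr_gt0.
pose u x := \int[mu]_t (gauss1 b c t * cos (x * (t - c) + th)).
have du y : has_deriv u y (- (y / (2 * b)) * u y).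
  pose f (y : R) (t : measurableTypeR R) :=
    gauss1 b c t * cos (y * (t - c) + th).
  have df (z : R) t : has_deriv (f ^~ t)
    z (- ((t - c) * gauss1 b c t * sin (z * (t - c) + th))).
    have H : has_deriv (fun z => z * (t - c) + th) z (1 * (t - c) + 0).
      apply: has_derivD; last exact: has_deriv_cst.
      apply: has_deriv_eq (has_derivM (has_deriv_id z)
        (has_deriv_cst (t - c) z)) _.
      by cbv beta; ring.
    by apply: has_deriv_eq (has_derivZ _ (has_deriv_cos H)) _; cbv beta; ring.
  have pf z t : partial1of2 f z t = - ((t - c)
    * gauss1 b c t * sin (z * (t - c) + th)).
    by rewrite partial1of2E; have [_ ->] := df z t.
  have I0 : `](y - 1), (y + 1)[%classic y.
    by rewrite /= in_itv/= ltrBlDr ltrDl ltr01.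
  have df' z (t : measurableTypeR R) (_ : `](y - 1), (y + 1)[%classic z)
      (_ : [set: measurableTypeR R] t) : derivable (f ^~ t) z 1.
    by have [] := df z t.
  pose G t := (1 + 2 / b) * gauss1 (b / 2) c t.
  have G0 t : 0 <= G t.
    by rewrite mulr_ge0 ?(ltW (gauss1_gt0 _ _ _))// addr_ge0// divr_ge0// ltW.
  have intG : mu.-integrable setT (EFin \o G).
    exact: (integrableZl measurableT (1 + 2 / b) (integrable_gauss1 c b20)).
  have GF z (t : measurableTypeR R) (_ : `](y - 1), (y + 1)[%classic z)
      (_ : [set: measurableTypeR R] t) : `|partial1of2 f z t| <= G t.
    by rewrite pf normrN; exact: gauss1_absorbM (ler_norm_sin _).
  have intf z (_ : `](y - 1), (y + 1)[%classic z) :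
    mu.-integrable setT (EFin \o f z).
    exact: integrable_gauss1_cos.
  have D := derivable_under_integral (@measurableT _ (measurableTypeR R))
    I0 intf df' G0 intG GF.
  have E := differentiation_under_integral (@measurableT _ (measurableTypeR R))
    I0 intf df' G0 intG GF.
  split; first exact: D.
  rewrite -derive1E E mulNr /u.
  rewrite (_ : y / (2 * b) * _ =
    \int[mu]_t ((t - c) * gauss1 b c t * sin (y * (t - c) + th))); last first.
    by rewrite gauss1_by_parts.
  rewrite -mulN1r -RintegralZl//; last exact: integrable_gauss1_linear_sin.
  by apply: eq_Rintegral => t _; rewrite pf mulN1r.
pose e (y : R) := expR ((4 * b)^-1 * y ^+ 2).
have de y : has_deriv e y (e y * (y / (2 * b))).
  apply: has_deriv_expR.
  apply: has_deriv_eq (has_derivZ _ (has_derivM (has_deriv_id y)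
    (has_deriv_id y))) _.
  by cbv beta; field; rewrite gt_eqF.
have cst (y : R) : u y * e y = u 0 * e 0.
  apply: (@is_derive_0_is_cst R (fun z => u z * e z)) => z.
  by apply: has_deriv_eq (has_derivM (du z) (de z)) _; cbv beta; ring.
have u0 : u 0 = Num.sqrt (pi / b) * cos th.
  rewrite /u -(Rintegral_gauss1 c b0) -RintegralZr//;
    last exact: integrable_gauss1.
  by apply: eq_Rintegral => t _; rewrite mul0r add0r.
have := cst x; rewrite u0 /e [0 ^+ 2]expr0n mulr0 expR0 mulr1.
rewrite -/(u x) => H; apply: (@mulIf _ (expR ((4 * b)^-1 * x ^+ 2))).
  by rewrite gt_eqF// expR_gt0.
have ee : expR (- (x ^+ 2 / (4 * b))) * expR ((4 * b)^-1 * x ^+ 2) = 1.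
  by rewrite -expRD -[RHS]expR0; congr expR; field; rewrite gt_eqF.
by rewrite H mulrAC -[_ * expR _ * expR _]mulrA ee mulr1.
Qed.

Local Open Scope complex_scope.

Lemma cintegrable_gauss1_cis b c x : 0 < b ->
  cintegrable mu (fun t => (gauss1 b c t)%:C * cis (x * t)).
Proof.
move=> b0; apply: (cintegrable_le _ (integrable_gauss1 c b0)).
  apply: cmeasurableM; first by apply: cmeasurable_real;
    exact: measurable_gauss1.
  by apply: cmeasurable_cis; exact: measurable_funM.
move=> t; rewrite Normc.normcM normc_cis mulr1 normc_real ger0_norm//.
exact: ltW (gauss1_gt0 _ _ _).
Qed.

Lemma cint_gauss1_cis b c x : 0 < b ->
  cint mu (fun t => (gauss1 b c t)%:C * cis (x * t)) =
  (Num.sqrt (pi / b) * gauss1 (4 * b)^-1 0 x)%:C * cis (x * c).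
Proof.
move=> b0; have E : gauss1 (4 * b)^-1 0 x = expR (- (x ^+ 2 / (4 * b))).
  by rewrite /gauss1 subr0; congr expR; rewrite mulrC.
apply: complexP; rewrite ?ReM ?ImM /= !mul0r ?subr0 ?addr0.
  rewrite E -(gauss1_cos_transform c _ _ b0); apply: eq_Rintegral => t _.
  by rewrite mul0r subr0; congr (_ * cos _); ring.
have cp y : cos (y - pi / 2) = sin y :> R by rewrite cosB cos_pihalf sin_pihalf
  mulr0 add0r mulr1.
rewrite E -cp -(gauss1_cos_transform c _ _ b0); apply: eq_Rintegral => t _.
by rewrite mul0r addr0 -cp; congr (_ * cos _); ring.
Qed.

End gaussian_fourier.

Section gaussian_fourier_rV.
Context {R : realType} {d : nat}.
Local Notation L := (lebesgue_rV R d).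
Local Open Scope complex_scope.
Implicit Types (a b : R) (c x xi : 'rV[R]_d).

Definition gauss b c x : R := expR (- (b * dot (x - c) (x - c))).

(** Its Fourier transform is a Gaussian centred at the frequency [c]. *)
Definition wave a c x : R[i] := (gauss a 0 x)%:C * cis (dot c x).

Lemma gauss_prod b c x : gauss b c x = \prod_i gauss1 b (c ord0 i) (x ord0 i).
Proof.
rewrite /gauss /dot /gauss1 mulr_sumr -sumrN expR_sum.
by apply: eq_bigr => i _; rewrite !mxE expr2.
Qed.

Lemma gauss_ge0 b c x : 0 <= gauss b c x.
Proof. exact: expR_ge0. Qed.

Lemma integral_gauss b c : 0 < b ->
  (\int[L]_x (gauss b c x)%:E)%E = (Num.sqrt (pi / b) ^+ d)%:E.
Proof.
move=> b0; under eq_integral do rewrite gauss_prod.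
rewrite (ge0_integral_rV_prod (h := fun i => gauss1 b (c ord0 i)));
  last 2 first.
- by move=> i; exact: measurable_gauss1.
- by move=> i t; exact: ltW (gauss1_gt0 _ _ _).
under eq_bigr do rewrite integral_gauss1//.
by rewrite prodEFin prodr_const card_ord.
Qed.

Lemma integrable_gauss b c : 0 < b -> L.-integrable setT (EFin \o gauss b c).
Proof.
move=> b0; have -> : EFin \o gauss b c =
    (fun x => (\prod_i gauss1 b (c ord0 i) (x ord0 i))%:E).
  by apply/funext => x /=; rewrite gauss_prod.
by apply: (integrable_rV_prod (h := fun i => gauss1 b (c ord0 i))) => i;
  exact: integrable_gauss1.
Qed.

Lemma Rintegral_gauss b c : 0 < b -> \int[L]_x gauss b c x = Num.sqrt (pi / b)
  ^+ d.
Proof. by move=> b0; rewrite /Rintegral integral_gauss. Qed.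

Lemma cis_dot x xi : cis (dot x xi) = \prod_i cis (x ord0 i * xi ord0 i)
  :> R[i].
Proof. exact: cis_sum. Qed.

(** Gaussian and character are both tensor products; this one formula serves as
    the Fourier transform of a wave and, read backwards, as its inversion. *)
Lemma cint_gauss_cis b c x : 0 < b ->
  cintegrable L (fun xi => (gauss b c xi)%:C * cis (dot x xi)) /\
  cint L (fun xi => (gauss b c xi)%:C * cis (dot x xi)) =
  (Num.sqrt (pi / b) ^+ d)%:C * wave (4 * b)^-1 c x.
Proof.
move=> b0.
have -> : (fun xi => (gauss b c xi)%:C * cis (dot x xi)) =
    (fun xi => \prod_i ((gauss1 b (c ord0 i) (xi ord0 i))%:C * cis
      (x ord0 i * xi ord0 i))).
  by apply/funext => xi; rewrite gauss_prod realc_prod cis_dot big_split.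
have [i1 e1] := cint_rV_prod
  (h := fun i t => (gauss1 b (c ord0 i) t)%:C * cis (x ord0 i * t))
  (fun i => cintegrable_gauss1_cis _ _ b0).
split => //; rewrite e1.
under eq_bigr do rewrite cint_gauss1_cis//.
rewrite big_split /= -realc_prod big_split /=
  prodr_const card_ord realcM -mulrA.
congr (_ * _); rewrite /wave gauss_prod; congr ((_ )%:C * _).
  by apply: eq_bigr => i _; rewrite mxE.
by rewrite cis_dot; apply: eq_bigr => i _; rewrite mulrC.
Qed.

Lemma dotC x xi : dot x xi = dot xi x.
Proof. by apply: eq_bigr => i _; rewrite mulrC. Qed.

Lemma dotDl x y xi : dot (x + y) xi = dot x xi + dot y xi.
Proof. by rewrite -big_split; apply: eq_bigr => i _; rewrite mxE mulrDl. Qed.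

Lemma dotNl x xi : dot (- x) xi = - dot x xi.
Proof. by rewrite /dot -sumrN; apply: eq_bigr => i _; rewrite mxE mulNr. Qed.

Lemma dotZl (t : R) x xi : dot (t *: x) xi = t * dot x xi.
Proof. by rewrite /dot mulr_sumr; apply: eq_bigr => i _; rewrite mxE mulrA. Qed.

Lemma dot_ge0 x : 0 <= dot x x.
Proof. by apply: sumr_ge0 => i _; rewrite -expr2 sqr_ge0. Qed.

Lemma fourier_wave a c xi : 0 < a ->
  cintegrable L (fun x => wave a c x * cis (- dot x xi)) /\
  fourier (wave a c) xi = (Num.sqrt (pi / a) ^+ d * gauss (4 * a)^-1 c xi)%:C.
Proof.
move=> a0.
have E : (fun x => wave a c x * cis (- dot x xi)) =
    (fun x => (gauss a 0 x)%:C * cis (dot (c - xi) x)).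
  apply/funext => x; rewrite /wave -mulrA -cisD; congr (_ * cis _).
  by rewrite dotDl dotNl [dot xi x]dotC.
have [i1 e1] := cint_gauss_cis 0 (c - xi) a0.
split; first by rewrite E.
rewrite /fourier -[cintegral _ _]/(cint L
  (fun x => wave a c x * cis (- dot x xi))) E e1.
rewrite /wave (_ : dot 0 _ = 0); last by rewrite /dot big1// => i _;
  rewrite mxE mul0r.
rewrite cis0 mulr1 -realcM; congr (_ * _)%:C;
  rewrite /gauss subr0 -opprB dotNl dotC dotNl opprK.
by [].
Qed.

End gaussian_fourier_rV.

(** * Decay of oscillatory integrals by finite differences *)

Section finite_differences.
Context {R : realType}.

(** The factor [1/2] makes integration against a character of period [2 v]
    invariant under this operation. *)
Definition half_diff {V : nmodType} (v : V) (h : V -> R) : V -> R :=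
  fun t => (h t - h (t + v)) / 2.

(** Each difference costs one derivative and gains a factor [`|delta|], by the
    mean value theorem. *)
Lemma half_diff_iter_bound n (phi : nat -> R -> R) (delta t0 K : R) :
  (forall k t, has_deriv (phi k) t (phi k.+1 t)) ->
  (forall t, `|t - t0| <= n%:R * `|delta| -> `|phi n t| <= K) ->
  `|iter n (half_diff delta) (phi 0%N) t0| <= `|delta| ^+ n * K.
Proof.
elim: n phi t0 K => [|n IH] phi t0 K dphi phiK.
  by rewrite expr0 mul1r; apply: phiK; rewrite subrr normr0 mul0r.
rewrite iterSr exprSr -mulrA.
apply: (IH (fun k => half_diff delta (phi k))) => [k t|t tn].
  have H : has_deriv (fun t => t + delta) t (1 + 0).
    by apply: has_derivD; [exact: has_deriv_id|exact: has_deriv_cst].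
  have := has_derivZ 2^-1 (has_derivB (dphi k t) (has_deriv_comp (f := phi k)
    (g := fun t => t + delta) (dphi k (t + delta)) H)).
  rewrite addr0 mulr1 => H2; rewrite /half_diff [X in has_deriv _ _ X]mulrC.
  by under eq_fun do rewrite mulrC.
have step (a b : R) : a <= b -> (forall s, s \in `[a, b]%R ->
  `|phi n.+1 s| <= K) ->
    `|phi n b - phi n a| <= (b - a) * K.
  move=> ab phiab.
  have [||s sab ->] := @MVT_segment R (phi n) (phi n.+1) a b ab.
  - by move=> s _; exact: dphi.
  - by apply: continuous_subspaceT => s; exact: has_deriv_continuous (dphi n s).
  rewrite normrM mulrC (ger0_norm (_ : 0 <= b - a)) ?subr_ge0//.
  by rewrite ler_wpM2l ?subr_ge0//; exact: phiab.
have bound s : `|s - t| <= `|delta| -> `|phi n.+1 s| <= K.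
  move=> st; apply: phiK; rewrite -[s - t0](subrKA t);
    apply: le_trans (ler_normD _ _) _.
  by rewrite -natr1 mulrDl mul1r addrC lerD.
have key : `|phi n t - phi n (t + delta)| <= `|delta| * K.
  have [d0|d0] := leP 0 delta.
    rewrite distrC (ger0_norm d0) -[X in X * K](addrK t) [delta + t]addrC.
    apply: step => [|s]; first by rewrite lerDl.
    rewrite in_itv/= => /andP[ts st]; apply: bound.
    by rewrite (ger0_norm d0) ger0_norm ?subr_ge0// lerBlDl.
  have -> : `|delta| = t - (t + delta) by rewrite (ltr0_norm d0); ring.
  apply: step => [|s]; first by rewrite gerDl ltW.
  rewrite in_itv/= => /andP[ts st]; apply: bound.
  by rewrite (ltr0_norm d0) ler0_norm ?subr_le0//; lra.
rewrite /half_diff normrM (ger0_norm (_ : 0 <= 2^-1)) ?invr_ge0//.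
apply: (le_trans (ler_piMr _ _)) => //.
by rewrite invf_le1// ler1n.
Qed.

Lemma half_diff_line {V : lmodType R} n (h : V -> R) (x e : V) (delta t : R) :
  iter n (half_diff (delta *: e)) h (x + t *: e) =
  iter n (half_diff delta) (fun s => h (x + s *: e)) t.
Proof.
elim: n t => [//|n IH] t; rewrite !iterS {1}/half_diff IH.
by rewrite -addrA -scalerDl IH.
Qed.

End finite_differences.

Section oscillatory_integral.
Context {R : realType} {d : nat}.
Local Notation L := (lebesgue_rV R d).
Local Open Scope complex_scope.
Implicit Types (h : 'rV[R]_d -> R) (x xi v : 'rV[R]_d).

(** An inverse Fourier transform, up to the normalizing constant. *)
Definition osc h x : R[i] := cint L (fun xi => (h xi)%:C * cis (dot x xi)).

Lemma measurable_dotr x : measurable_fun setT (fun xi : 'rV[R]_d => dot x xi).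
Proof.
apply: measurable_sum => i; apply: measurable_funM => //.
exact: measurable_rV_entry.
Qed.

Lemma cintegrable_osc h x : L.-integrable setT (EFin \o h) ->
  cintegrable L (fun xi => (h xi)%:C * cis (dot x xi)).
Proof.
move=> ih; apply: (cintegrable_le _ (integrable_norm ih)).
  apply: cmeasurableM.
    by apply: cmeasurable_real; apply/measurable_EFinP;
      exact: measurable_int ih.
  by apply: cmeasurable_cis; exact: measurable_dotr.
by move=> xi; rewrite Normc.normcM normc_cis mulr1 normc_real.
Qed.

Lemma osc_bound h (g : 'rV[R]_d -> R) x : measurable_fun setT h ->
  L.-integrable setT (EFin \o g) -> (forall xi, `|h xi| <= g xi) ->
  Normc.normc (osc h x) <= 2 * \int[L]_xi g xi.
Proof.
move=> mh ig hg.
have ih : L.-integrable setT (EFin \o h).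
  apply: le_integrable ig => //; first exact/measurable_EFinP.
  by move=> xi _; rewrite lee_fin (le_trans (hg xi))// ler_norm.
apply: normc_cint_le => //; first exact: cintegrable_osc.
by move=> xi; rewrite Normc.normcM normc_cis mulr1 normc_real.
Qed.

Lemma oscB h k x : L.-integrable setT (EFin \o h) ->
  L.-integrable setT (EFin \o k) ->
  osc (fun xi => h xi - k xi) x = osc h x - osc k x.
Proof.
move=> ih ik.
have iN := cintegrable_osc x ik.
rewrite /osc -mulN1r -(cintZ (-1) iN) -cintD; last 2 first.
- exact: cintegrable_osc.
- exact: cintegrableZ.
apply: eq_cint => xi; rewrite mulrA -mulrDl; congr (_ * _).
by apply: complexP; rewrite ?ReD ?ImD ?ReM ?ImM /=; ring.
Qed.

Lemma oscZ h (a : R) x : L.-integrable setT (EFin \o h) ->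
  osc (fun xi => a * h xi) x = a%:C * osc h x.
Proof.
move=> ih; rewrite /osc -(cintZ _ (cintegrable_osc x ih)).
by apply: eq_cint => xi; rewrite realcM mulrA.
Qed.

Lemma cint_shift (F : 'rV[R]_d -> R[i]) v : cmeasurable F ->
  cint L (fun xi => F (xi + v)) = cint L F.
Proof.
move=> [mr mi]; rewrite /cint.
by rewrite (Rintegral_rV_shift v mr) (Rintegral_rV_shift v mi).
Qed.

Lemma integrable_shift h v : L.-integrable setT (EFin \o h) ->
  L.-integrable setT (EFin \o (fun xi => h (xi + v))).
Proof.
move=> ih; have mh : measurable_fun setT h.
  by apply/measurable_EFinP; exact: measurable_int ih.
apply/integrableP; split.
  by apply/measurable_EFinP; apply: measurableT_comp => //;
    exact: measurable_rV_shift.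
rewrite (ge0_integral_rV_shift (F := fun xi => `|h xi|%:E))//.
  by have /integrableP[] := ih.
by apply/measurable_EFinP; exact: measurableT_comp.
Qed.

Lemma integrable_half_diff h v : L.-integrable setT (EFin \o h) ->
  L.-integrable setT (EFin \o half_diff v h).
Proof.
move=> ih; apply: eq_integrable
  (integrableZl measurableT 2^-1 (integrableB measurableT ih
    (integrable_shift v ih))) => //.
by move=> xi _ /=; rewrite /half_diff [RHS]/= mulrC EFinM EFinB.
Qed.

(** Translating by half a period of the character changes the sign of the
    oscillatory integral, so it equals half its difference with the translated
    one: an integration by parts without derivatives. *)
Lemma osc_half_diff h v x : L.-integrable setT (EFin \o h) -> dot x v = pi ->
  osc (half_diff v h) x = osc h x.
Proof.
move=> ih xv; have ihv := integrable_shift v ih.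
have shiftE : osc (fun xi => h (xi + v)) x = - osc h x.
  have mh : measurable_fun setT h by apply/measurable_EFinP;
    exact: measurable_int ih.
  rewrite /osc -[in RHS](@cint_shift (fun xi => (h xi)%:C * cis (dot x xi)) v);
    last first.
    exact: cintegrable_measurable (cintegrable_osc x ih).
  have ic := cintegrable_osc x ihv.
  rewrite -mulN1r -cintZ.
    apply: eq_cint => xi.
    have -> : dot x (xi + v) = dot x xi + pi by rewrite dotC dotDl
      ![dot _ x]dotC xv.
    rewrite cisD (_ : cis pi = -1); last first.
      by apply: complexP; rewrite /cis /= ?cospi ?sinpi ?oppr0.
    by rewrite mulrN1 mulrN mulN1r opprK.
  have -> : (fun xi => (h (xi + v))%:C * cis (dot x (xi + v))) =
     (fun xi => cis pi * ((h (xi + v))%:C * cis (dot x xi))).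
    apply/funext => xi; rewrite dotC dotDl ![dot _ x]dotC xv cisD.
    by rewrite mulrA mulrC.
  exact: cintegrableZ.
have -> : half_diff v h = (fun xi => 2^-1 * (h xi - h (xi + v))).
  by apply/funext => xi; rewrite /half_diff mulrC.
rewrite oscZ; last first.
  by apply: eq_integrable (integrableB measurableT ih ihv) => // xi _ /=;
    rewrite EFinB.
rewrite oscB// shiftE opprK mulrDr -mulrDl -realcD.
by rewrite (_ : 2^-1 + 2^-1 = 1 :> R) ?mul1r//; field.
Qed.

Lemma osc_half_diff_iter n h v x : L.-integrable setT (EFin \o h) -> dot x v =
  pi ->
  L.-integrable setT (EFin \o iter n (half_diff v) h) /\
  osc (iter n (half_diff v) h) x = osc h x.
Proof.
move=> ih xv; elim: n => [//|n [IHi IHe]]; split;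
  first exact: integrable_half_diff.
by rewrite iterS osc_half_diff.
Qed.

End oscillatory_integral.

(** * Derivatives of the Bessel symbol against a Gaussian *)

Section symbol_estimates.
Context {R : realType} {d : nat}.
Implicit Types (c x xi eta : 'rV[R]_d) (b q N : R) (j : 'I_d).

(** The square of the Japanese bracket. *)
Definition bra xi : R := 1 + dot xi xi.

Lemma bra_ge1 xi : 1 <= bra xi.
Proof. by rewrite lerDl dot_ge0. Qed.

Lemma bra_gt0 xi : 0 < bra xi.
Proof. exact: lt_le_trans ltr01 (bra_ge1 xi). Qed.

Lemma sqr_le_dot xi j : xi ord0 j ^+ 2 <= dot xi xi.
Proof.
rewrite /dot (bigD1 j)//= -expr2 lerDl; apply: sumr_ge0 => i _.
by rewrite -expr2 sqr_ge0.
Qed.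

Lemma norm_le_bra xi j : `|xi ord0 j| <= bra xi.
Proof.
apply: (@le_trans _ _ (1 + xi ord0 j ^+ 2)); last by rewrite lerD2l sqr_le_dot.
rewrite -(real_normK (num_real (xi ord0 j))); have := normr_ge0 (xi ord0 j).
by move: `|_| => z z0; have := sqr_ge0 (z - 1); nra.
Qed.

Lemma dotD_le x y : dot (x + y) (x + y) <= 2 * dot x x + 2 * dot y y.
Proof.
rewrite /dot !mulr_sumr -big_split; apply: ler_sum => i _ /=; rewrite mxE.
by have := sqr_ge0 (x ord0 i - y ord0 i); nra.
Qed.

Lemma dot_delta j : dot (delta_mx ord0 j) (delta_mx ord0 j) = 1 :> R.
Proof.
rewrite /dot (bigD1 j)//= !mxE !eqxx mul1r big1 ?addr0// => i ij.
by rewrite !mxE (negbTE ij) andbF mul0r.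
Qed.

Lemma dot_deltar xi j : dot xi (delta_mx ord0 j) = xi ord0 j.
Proof.
rewrite /dot (bigD1 j)//= !mxE !eqxx mulr1 big1 ?addr0// => i ij.
by rewrite !mxE (negbTE ij) andbF mulr0.
Qed.

Lemma dot_line xi j (t : R) :
  dot (xi + t *: delta_mx ord0 j) (xi + t *: delta_mx ord0 j) =
  dot xi xi + 2 * t * xi ord0 j + t ^+ 2.
Proof.
rewrite dotDl dotZl [dot xi _]dotC [dot (delta_mx _ _) _]dotC !dotDl !dotZl.
rewrite dot_delta [dot (delta_mx _ _) xi]dotC dot_deltar.
by ring.
Qed.

Lemma entry_line xi j (t : R) : (xi + t *: delta_mx ord0 j) ord0 j =
  xi ord0 j + t.
Proof. by rewrite !mxE !eqxx mulr1. Qed.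

(** The symbol of the Bessel potential against a Gaussian: up to constants, the
    Fourier transform of the Bessel potential of a [wave]. *)
Definition sym q b c xi : R := bra xi `^ q * gauss b c xi.

(** Polynomials in [xi_j / bra xi], [1 / bra xi] and [xi_j - c_j]: the
    derivatives of [sym q b c] along the [j]-th axis are products of [sym q b c]
    with such an expression. The syntax carries neither [c] nor [j], which makes
    every estimate obtained by induction on it uniform in them. *)
Inductive expr :=
| Const of R | Alpha | Beta | Gam
| Add of expr & expr | Mul of expr & expr.

Fixpoint eval c j xi (e : expr) : R :=
  match e with
  | Const k => k
  | Alpha => xi ord0 j * (bra xi)^-1
  | Beta => (bra xi)^-1
  | Gam => xi ord0 j - c ord0 j
  | Add e1 e2 => eval c j xi e1 + eval c j xi e2
  | Mul e1 e2 => eval c j xi e1 * eval c j xi e2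
  end.

Fixpoint deriv_expr (e : expr) : expr :=
  match e with
  | Const _ => Const 0
  | Alpha => Add Beta (Mul (Const (- 2)) (Mul Alpha Alpha))
  | Beta => Mul (Const (- 2)) (Mul Alpha Beta)
  | Gam => Const 1
  | Add e1 e2 => Add (deriv_expr e1) (deriv_expr e2)
  | Mul e1 e2 => Add (Mul e1 (deriv_expr e2)) (Mul e2 (deriv_expr e1))
  end.

(** [Alpha] and [Gam] enter through the logarithmic derivative of
    [sym q b c]. *)
Definition next_expr q b e : expr :=
  Add (deriv_expr e)
      (Mul (Add (Mul (Const (2 * q)) Alpha) (Mul (Const (- (2 * b))) Gam)) e).

Lemma has_deriv_entry xi j t :
  has_deriv (fun t => (xi + t *: delta_mx ord0 j) ord0 j) t 1.
Proof.
under eq_fun do rewrite entry_line.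
apply: has_deriv_eq (has_derivD (has_deriv_cst _ _) (has_deriv_id _)) _.
by rewrite add0r.
Qed.

Lemma has_deriv_bra xi j t :
  has_deriv (fun t => bra (xi + t *: delta_mx ord0 j)) t
    (2 * (xi + t *: delta_mx ord0 j) ord0 j).
Proof.
rewrite /bra; under eq_fun do rewrite dot_line; rewrite entry_line.
apply: has_deriv_eq.
  apply: has_derivD; first exact: has_deriv_cst.
  apply: has_derivD; last exact: (has_derivM (has_deriv_id t) (has_deriv_id t)).
  apply: has_derivD; first exact: has_deriv_cst.
  apply: has_derivM; last exact: has_deriv_cst.
  exact: has_derivZ (has_deriv_id t).
by cbv beta; ring.
Qed.

Lemma has_deriv_eval c j xi e t :
  has_deriv (fun t => eval c j (xi + t *: delta_mx ord0 j) e) t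
    (eval c j (xi + t *: delta_mx ord0 j) (deriv_expr e)).
Proof.
have b0 := lt0r_neq0 (bra_gt0 (xi + t *: delta_mx ord0 j)).
have db := has_deriv_inv (f := fun t => bra (xi + t *: delta_mx ord0 j))
  b0 (has_deriv_bra xi j t).
have de := has_deriv_entry xi j t.
elim: e => [k||||e1 IH1 e2 IH2|e1 IH1 e2 IH2] /=.
- exact: has_deriv_cst.
- by apply: has_deriv_eq (has_derivM de db) _; cbv beta; field.
- by apply: has_deriv_eq db _; cbv beta; field.
- apply: has_deriv_eq (has_derivB de (has_deriv_cst _ _)) _.
  by rewrite subr0.
- exact: has_derivD IH1 IH2.
- exact: has_derivM IH1 IH2.
Qed.

Lemma has_deriv_sym q b c j xi t :
  has_deriv (fun t => sym q b c (xi + t *: delta_mx ord0 j)) t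
   (eval c j (xi + t *: delta_mx ord0 j)
     (Add (Mul (Const (2 * q)) Alpha) (Mul (Const (- (2 * b))) Gam)) *
    sym q b c (xi + t *: delta_mx ord0 j)).
Proof.
have dg : has_deriv (fun t => gauss b c (xi + t *: delta_mx ord0 j)) t
    (gauss b c (xi + t *: delta_mx ord0 j) *
      (- (b * (2 * ((xi + t *: delta_mx ord0 j) ord0 j - c ord0 j))))).
  apply: has_deriv_expR; apply: has_derivN; apply: has_derivZ.
  have := has_deriv_bra (xi - c) j t; rewrite /bra => H.
  have := has_derivB H (has_deriv_cst 1 t).
  rewrite subr0 !entry_line [(xi - c) ord0 j]mxE [(- c) ord0 j]mxE addrAC.
  congr has_deriv; apply/funext => s.
  by rewrite addrC addKr addrAC.
have b0 := bra_gt0 (xi + t *: delta_mx ord0 j).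
have dp := has_deriv_powR (f := fun t => bra (xi + t *: delta_mx ord0 j))
  q b0 (has_deriv_bra xi j t).
rewrite /sym; apply: has_deriv_eq (has_derivM dp dg) _ => /=.
have -> : bra (xi + t *: delta_mx ord0 j) `^ (q - 1) =
    bra (xi + t *: delta_mx ord0 j) `^ q * (bra (xi + t *: delta_mx ord0 j))^-1.
  by rewrite powRB ?(lt0r_neq0 b0) ?implybT// powRr1// ltW.
by cbv beta; ring.
Qed.

(** One step of differentiation; iterating [next_expr] from [Const 1] describes
    all the derivatives of [sym q b c]. *)
Lemma has_deriv_eval_sym q b c j xi e t :
  has_deriv (fun t => eval c j (xi + t *: delta_mx ord0 j) e *
                      sym q b c (xi + t *: delta_mx ord0 j)) t
   (eval c j (xi + t *: delta_mx ord0 j) (next_expr q b e) *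
    sym q b c (xi + t *: delta_mx ord0 j)).
Proof.
apply: has_deriv_eq (has_derivM (has_deriv_eval c j xi e t)
  (has_deriv_sym q b c j xi t)) _.
by rewrite /next_expr /=; ring.
Qed.

Lemma eval_bound e : exists (C : R) (n : nat), 0 <= C /\
  forall c j xi, `|eval c j xi e| <= C * bra (xi - c) ^+ n.
Proof.
elim: e => [k||||e1 [C1 [n1 [C10 H1]]] e2 [C2 [n2 [C20 H2]]]
  |e1 [C1 [n1 [C10 H1]]] e2 [C2 [n2 [C20 H2]]]] /=.
- by exists `|k|, 0%N; split=> // c j xi; rewrite expr0 mulr1.
- exists 1, 0%N; split=> // c j xi; rewrite expr0 mulr1.
  rewrite normrM normfV (ger0_norm (ltW (bra_gt0 xi))).
  by rewrite ler_pdivrMr ?bra_gt0// mul1r norm_le_bra.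
- exists 1, 0%N; split=> // c j xi; rewrite expr0 mulr1.
  rewrite ger0_norm ?invr_ge0 ?(ltW (bra_gt0 xi))//.
  by rewrite invf_le1 ?bra_gt0// bra_ge1.
- exists 1, 1%N; split=> // c j xi; rewrite expr1 mul1r.
  by have := norm_le_bra (xi - c) j; rewrite mxE [(- c) _ _]mxE.
- exists (C1 + C2), (n1 + n2)%N; split=> [|c j xi]; first exact: addr_ge0.
  apply: le_trans (ler_normD _ _) _; rewrite mulrDl; apply: lerD.
    apply: le_trans (H1 c j xi) _; rewrite ler_wpM2l// ler_weXn2l ?bra_ge1//.
    exact: leq_addr.
  apply: le_trans (H2 c j xi) _; rewrite ler_wpM2l// ler_weXn2l ?bra_ge1//.
  exact: leq_addl.
- exists (C1 * C2), (n1 + n2)%N; split=> [|c j xi]; first exact: mulr_ge0.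
  by rewrite normrM exprD mulrACA ler_pM.
Qed.

(** Polynomial growth is absorbed by half of the exponent. *)
Lemma poly_gauss_absorb b n : 0 < b ->
  exists C : R, 0 <= C /\
    forall c xi, bra (xi - c) ^+ n * gauss b c xi <= C * gauss (b / 2) c xi.
Proof.
move=> b0; case: n => [|n].
  exists 1; split=> // c xi; rewrite expr0 !mul1r /gauss ler_expR lerN2.
  by rewrite ler_wpM2r ?dot_ge0// ler_pdivrMr// ler_peMr ?(ltW b0)// ler1n.
set m := n.+1; have m0 : 0 < m%:R :> R by rewrite ltr0n.
have M0 : 0 <= 1 + 2 * m%:R / b.
  by rewrite addr_ge0// divr_ge0 ?(ltW b0)// mulr_ge0// ltW.
exists ((1 + 2 * m%:R / b) ^+ m); split; first exact: exprn_ge0.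
move=> c xi; rewrite /gauss /bra; move: (dot_ge0 (xi - c));
  move: (dot _ _) => y y0.
have -> : - (b * y) = m%:R * - (b / (2 * m%:R) * y) + - (b / 2 * y).
  by field; rewrite gt_eqF.
rewrite expRD expRM_natl mulrA ler_wpM2r ?expR_ge0// -exprMn.
apply: lerXn2r; rewrite ?nnegrE//; first by rewrite mulr_ge0 ?expR_ge0
  ?addr_ge0.
rewrite expRN ler_pdivrMr ?expR_gt0//.
apply: (@le_trans _ _ ((1 + 2 * m%:R / b) * (1 + b / (2 * m%:R) * y)));
  last first.
  by rewrite ler_wpM2l// expR_ge1Dx.
have -> : (1 + 2 * m%:R / b) * (1 + b / (2 * m%:R) * y) =
    1 + y + (2 * m%:R / b + b / (2 * m%:R) * y).
  by field; rewrite !gt_eqF.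
rewrite lerDl; apply: addr_ge0; first by rewrite divr_ge0 ?(ltW b0)// mulr_ge0//
  ltW.
by rewrite mulr_ge0// divr_ge0 ?(ltW b0)// mulr_ge0// ltW.
Qed.

(** Uniformity in the frequency [c]: a symbol is at most of the size it has on
    the sphere of radius [N], up to polynomial growth away from [c]. *)
Lemma bra_center N c xi : 1 <= N -> dot c c <= N ^+ 2 ->
  bra xi <= 3 * N ^+ 2 * bra (xi - c).
Proof.
move=> N1 cN; have N2 : 1 <= N ^+ 2 by rewrite exprn_ege1.
have := dotD_le c (xi - c); rewrite subrKC /bra; have := dot_ge0 (xi - c).
by move: (dot (xi - c) _) (dot xi xi) (dot c c) cN => u v w; nra.
Qed.

Lemma powR_bra_center q N c xi : 0 <= q -> 1 <= N -> dot c c <= N ^+ 2 ->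
  bra xi `^ q <= 3 `^ q * N `^ (2 * q) * bra (xi - c) ^+ (Num.trunc q).+1.
Proof.
move=> q0 N1 cN; have N0 : 0 <= N by exact: le_trans N1.
have w0 := ltW (bra_gt0 (xi - c)).
have n0 : 0 <= 3 * N ^+ 2 by rewrite mulr_ge0// sqr_ge0.
apply: (@le_trans _ _ ((3 * N ^+ 2 * bra (xi - c)) `^ q)).
  apply: ge0_ler_powR => //; rewrite ?nnegrE ?(ltW (bra_gt0 _))
    ?mulr_ge0 ?sqr_ge0//.
  exact: bra_center.
rewrite powRM// powRM ?sqr_ge0// -(powR_mulrn 2 N0) -powRrM.
rewrite ler_wpM2l ?mulr_ge0 ?powR_ge0//.
rewrite -powR_mulrn// ler_powR ?bra_ge1//.
by rewrite ltW// truncnS_gt.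
Qed.

Lemma eval_sym_bound q b e : 0 <= q -> 0 < b -> exists C : R, 0 <= C /\
  forall N c j xi, 1 <= N -> dot c c <= N ^+ 2 ->
  `|eval c j xi e * sym q b c xi| <= C * N `^ (2 * q) * gauss (b / 2) c xi.
Proof.
move=> q0 b0; have [C1 [n [C10 H1]]] := eval_bound e.
have [C2 [C20 H2]] := poly_gauss_absorb (n + (Num.trunc q).+1) b0.
exists (C1 * 3 `^ q * C2); split=> [|N c j xi N1 cN];
  first by rewrite !mulr_ge0 ?powR_ge0.
rewrite normrM /sym (ger0_norm (_ : 0 <= _ * _))
  ?mulr_ge0 ?powR_ge0 ?gauss_ge0//.
apply: (@le_trans _ _ ((C1 * bra (xi - c) ^+ n) *
  (3 `^ q * N `^ (2 * q) * bra (xi - c) ^+ (Num.trunc q).+1 * gauss b c xi))).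
  apply: ler_pM => //; first by rewrite mulr_ge0 ?powR_ge0 ?gauss_ge0.
  by rewrite ler_wpM2r ?gauss_ge0//; exact: powR_bra_center.
have -> : (C1 * bra (xi - c) ^+ n) *
  (3 `^ q * N `^ (2 * q) * bra (xi - c) ^+ (Num.trunc q).+1 * gauss b c xi) =
  (C1 * 3 `^ q * N `^ (2 * q)) * (bra (xi - c) ^+ (n + (Num.trunc q).+1)
    * gauss b c xi).
  by rewrite exprD; ring.
apply: (@le_trans _ _ ((C1 * 3 `^ q * N `^ (2 * q))
  * (C2 * gauss (b / 2) c xi))).
  by rewrite ler_wpM2l ?mulr_ge0 ?powR_ge0.
by rewrite le_eqVlt; apply/orP; left; apply/eqP; ring.
Qed.

(** Moving by [t] along an axis costs a constant factor and half of the
    exponent; this turns a bound on the derivatives along a segment into a bound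
    at its end point. *)
Lemma gauss_line b c xi j t : 0 < b ->
  gauss b c (xi + t *: delta_mx ord0 j) <= expR (b * t ^+ 2) * gauss (b / 2)
    c xi.
Proof.
move=> b0; rewrite /gauss -expRD ler_expR.
have := dotD_le (xi + t *: delta_mx ord0 j - c) (- t *: delta_mx ord0 j).
rewrite scaleNr addrAC addrK [X in _ <= _ + 2 * X](_ : _ = t ^+ 2); last first.
  rewrite -scaleNr dotZl dotC dotZl dot_delta; ring.
move: (dot _ _) (dot _ _) => u v uv.
by have := ler_wpM2l (ltW b0) uv; lra.
Qed.

Lemma measurable_gauss b c : measurable_fun setT (gauss b c).
Proof.
have -> : gauss b c = (fun x => \prod_i gauss1 b (c ord0 i) (x ord0 i)).
  by apply/funext => x; exact: gauss_prod.
apply: measurable_prod => i _; apply: measurableT_comp;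
  first exact: measurable_gauss1.
exact: measurable_rV_entry.
Qed.

Lemma measurable_bra : measurable_fun setT bra.
Proof.
apply: measurable_funD => //; apply: measurable_sum => i.
by apply: measurable_funM; exact: measurable_rV_entry.
Qed.

Lemma measurable_sym q b c : measurable_fun setT (sym q b c).
Proof.
apply: measurable_funM; last exact: measurable_gauss.
exact: (measurableT_comp (measurable_powR q) measurable_bra).
Qed.

Lemma integrable_sym q b c : 0 <= q -> 0 < b ->
  (lebesgue_rV R d).-integrable setT (EFin \o sym q b c).
Proof.
move=> q0 b0; have b20 : 0 < b / 2 by rewrite divr_gt0.
pose N := 1 + dot c c.
have N1 : 1 <= N by rewrite lerDl dot_ge0.
have cN : dot c c <= N ^+ 2 by rewrite /N; have := dot_ge0 c;
  move: (dot c c) => z; nra.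
have [C [_ H]] := poly_gauss_absorb (Num.trunc q).+1 b0.
apply: le_integrable (integrableZl measurableT (3 `^ q * N `^ (2 * q) * C)
  (integrable_gauss c b20)) => //; first by apply/measurable_EFinP;
    exact: measurable_sym.
move=> xi _ /=; rewrite lee_fin; apply: (le_trans _ (ler_norm _)).
rewrite /sym ger0_norm ?mulr_ge0 ?powR_ge0 ?gauss_ge0// -[_ * C * _]mulrA.
apply: le_trans (ler_wpM2l _ (H c xi)); last by rewrite mulr_ge0 ?powR_ge0.
by rewrite mulrA ler_wpM2r ?gauss_ge0//; exact: powR_bra_center.
Qed.

(** The differences along any axis are dominated by a Gaussian centred at [c]
    with a constant of the order of the symbol itself, [N ^ (2 q)]. *)
Lemma sym_half_diff_bound q b n : 0 <= q -> 0 < b -> exists C : R, 0 <= C /\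
  forall N c j xi (delta : R), 1 <= N -> dot c c <= N ^+ 2 -> `|delta| <= pi ->
  `|iter n (half_diff (delta *: delta_mx ord0 j)) (sym q b c) xi| <=
    `|delta| ^+ n * (C * N `^ (2 * q) * gauss (b / 4) c xi).
Proof.
move=> q0 b0; have [C [C0 H]] := eval_sym_bound
  (iter n (next_expr q b) (Const 1)) q0 b0.
exists (C * expR (b / 2 * (n%:R * pi) ^+ 2));
  split=> [|N c j xi delta N1 cN dpi].
  by rewrite mulr_ge0// expR_ge0.
have := half_diff_line n (sym q b c) xi (delta_mx ord0 j) delta 0.
rewrite scale0r addr0 => ->.
pose phi k t := eval c j (xi + t *: delta_mx ord0 j)
  (iter k (next_expr q b) (Const 1)) *
  sym q b c (xi + t *: delta_mx ord0 j).
have -> : (fun s => sym q b c (xi + s *: delta_mx ord0 j)) = phi 0%N.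
  by apply/funext => s; rewrite /phi /= mul1r.
apply: half_diff_iter_bound => [k t|t]; first exact: has_deriv_eval_sym.
rewrite subr0 => tn; apply: le_trans (H N c j _ N1 cN) _.
have b20 : 0 < b / 2 by rewrite divr_gt0.
apply: le_trans (ler_wpM2l _ (gauss_line c xi j t b20)) _.
  by rewrite mulr_ge0// powR_ge0.
rewrite (_ : b / 2 / 2 = b / 4); last by field.
rewrite mulrA ler_wpM2r ?gauss_ge0// mulrAC ler_wpM2r ?powR_ge0//.
rewrite ler_wpM2l// ler_expR ler_wpM2l ?(ltW b20)//.
rewrite -(real_normK (num_real t)) lerXn2r ?nnegrE ?mulr_ge0 ?pi_ge0//.
by apply: (le_trans tn); rewrite ler_wpM2l.
Qed.

End symbol_estimates.

(** * Bessel potentials of waves and their decay *)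

Section bessel_wave.
Context {R : realType} {d : nat}.
Local Notation L := (lebesgue_rV R d).
Local Open Scope complex_scope.
Import Normc.
Implicit Types (a b q s N : R) (c x xi : 'rV[R]_d).

Definition wave_coeff a : R := ((2 * pi) ^+ d)^-1 * Num.sqrt (pi / a) ^+ d.

Lemma wave_coeff_ge0 a : 0 <= wave_coeff a.
Proof. by rewrite mulr_ge0 ?invr_ge0 ?exprn_ge0 ?mulr_ge0 ?pi_ge0 ?sqrtr_ge0.
  Qed.

Lemma bessel_wave a s c x : 0 < a -> 0 <= s ->
  bessel s (wave a c) x = (wave_coeff a)%:C * osc (sym (s / 2) (4 * a)^-1 c) x.
Proof.
move=> a0 s0; have b0 : 0 < (4 * a)^-1 by rewrite invr_gt0 mulr_gt0.
have q0 : 0 <= s / 2 by rewrite divr_ge0.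
rewrite /wave_coeff realcM -mulrA -oscZ; last exact: integrable_sym.
rewrite /bessel /fourier_multiplier /inv_fourier; congr (_ * _).
apply: eq_cint => xi; congr (_ * _); rewrite (fourier_wave c xi a0).2 -realcM.
by congr (_%:C); rewrite /sym /bra; ring.
Qed.

(** Linearity is not automatic for integrals: it holds here since each term is
    integrable. *)
Lemma bessel_sum_wave n (a : 'I_n -> R) s c x : (forall i, 0 < a i) -> 0 <= s ->
  bessel s (fun y => \sum_i wave (a i) c y) x = \sum_i bessel s (wave (a i) c)
    x.
Proof.
move=> a0 s0; have b0 i : 0 < (4 * a i)^-1 by rewrite invr_gt0 mulr_gt0.
have q0 : 0 <= s / 2 by rewrite divr_ge0.
under [RHS]eq_bigr => i _ do rewrite bessel_wave//
  /wave_coeff realcM -mulrA -oscZ ?integrable_sym//.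
rewrite -mulr_sumr /bessel /fourier_multiplier /inv_fourier; congr (_ * _).
rewrite -(proj2 (cint_sum _)); last first.
  move=> i; apply: cintegrable_osc.
  exact: (integrableZl measurableT (Num.sqrt (pi / a i) ^+ d)
    (integrable_sym c q0 (b0 i))).
apply: eq_cint => xi; rewrite -mulr_suml; congr (_ * _).
have -> : fourier (fun y => \sum_i wave (a i) c y) xi =
  \sum_i fourier (wave (a i) c) xi.
  rewrite /fourier -[LHS]/(cint L (fun y => (\sum_i wave (a i) c y)
    * cis (- dot y xi))).
  rewrite -(proj2 (cint_sum (fun i => (fourier_wave c xi (a0 i)).1))).
  by apply: eq_cint => y; rewrite mulr_suml.
rewrite mulr_sumr; apply: eq_bigr => i _;
  rewrite (fourier_wave c xi (a0 i)).2 -realcM.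
by congr (_%:C); rewrite /sym /bra; ring.
Qed.

(** Fourier inversion for a modulated Gaussian. *)
Lemma wave_osc a c x : 0 < a ->
  wave a c x = (wave_coeff a)%:C * osc (gauss (4 * a)^-1 c) x.
Proof.
move=> a0; have b0 : 0 < (4 * a)^-1 by rewrite invr_gt0 mulr_gt0.
have aE : (4 / (4 * a))^-1 = a by field; rewrite gt_eqF.
rewrite /osc (cint_gauss_cis c x b0).2 aE mulrA -realcM /wave_coeff.
rewrite -mulrA -exprMn -sqrtrM ?divr_ge0 ?pi_ge0 ?(ltW a0)//.
have -> : pi / a * (pi / (4 * a)^-1) = (2 * pi) ^+ 2 by field; rewrite gt_eqF.
rewrite sqrtr_sqr ger0_norm ?mulr_ge0 ?pi_ge0// mulVf ?mul1r//.
by rewrite expf_neq0// mulf_neq0 ?gt_eqF ?pi_gt0.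
Qed.

(** If [x_j] is the coordinate of largest modulus and [|x_j| > 1], then [2 d]
    differences of step [pi / x_j] along the [j]-th axis gain a factor
    [|x_j| ^ (- 2 d)], which is at most the product since
    [1 + x_i ^ 2 <= 2 x_j ^ 2]; if [|x_j| <= 1], each factor of the product is
    at least [1]. Differentiating along a single axis avoids mixed derivatives
    of the symbol. *)
Lemma bessel_wave_decay a s (i0 : 'I_d) : 0 < a -> 0 <= s -> exists C : R,
  0 <= C /\
  forall N c x, 1 <= N -> dot c c <= N ^+ 2 ->
  normc (bessel s (wave a c) x) <= C * N `^ s * \prod_i
    (2 / (1 + x ord0 i ^+ 2)).
Proof.
move=> a0 s0; set b := (4 * a)^-1; set q := s / 2.
have b0 : 0 < b by rewrite invr_gt0 mulr_gt0.
have b40 : 0 < b / 4 by rewrite divr_gt0.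
have q0 : 0 <= q by rewrite divr_ge0.
have q2 : 2 * q = s by rewrite /q; field.
have [C1 [C10 H1]] := sym_half_diff_bound 0 q0 b0 (d := d).
have [C2 [C20 H2]] := sym_half_diff_bound (d + d) q0 b0 (d := d).
pose I := Num.sqrt (pi / (b / 4)) ^+ d : R.
have I0 : 0 <= I by rewrite exprn_ge0 ?sqrtr_ge0.
have pik : 0 <= pi ^+ (d + d) * C2 by rewrite mulr_ge0// exprn_ge0 ?pi_ge0.
pose K := C1 + pi ^+ (d + d) * C2.
have K0 : 0 <= K by rewrite addr_ge0.
exists (wave_coeff a * (2 * (K * I))); split=> [|N c x N1 cN].
  by rewrite mulr_ge0 ?wave_coeff_ge0// mulr_ge0// mulr_ge0.
rewrite bessel_wave// normcM normc_real (ger0_norm (wave_coeff_ge0 a)).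
rewrite -/b -/q; move: (wave_coeff a) (wave_coeff_ge0 a) => w w0.
rewrite -!mulrA ler_wpM2l//.
have isym := integrable_sym c q0 b0.
have Ns0 : 0 <= N `^ s by exact: powR_ge0.
set P := \prod_i _.
(* [n = 0] is the trivial bound, by the integral of the modulus *)
have bnd n (v : 'rV[R]_d) (k : R) : 0 <= k -> n = 0%N \/ dot x v = pi ->
    (forall xi, `|iter n (half_diff v) (sym q b c) xi| <= k * gauss (b / 4)
      c xi) ->
    normc (osc (sym q b c) x) <= 2 * (k * I).
  move=> k0 nv Hk.
  have [ii ie] : L.-integrable setT (EFin \o iter n (half_diff v) (sym q b c))
    /\
      osc (iter n (half_diff v) (sym q b c)) x = osc (sym q b c) x.
    by case: nv => [->//|xv]; exact: osc_half_diff_iter.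
  rewrite -ie /I -(Rintegral_gauss c b40) -RintegralZl//;
    last exact: integrable_gauss.
  apply: osc_bound => //.
    by apply/measurable_EFinP; exact: measurable_int ii.
  exact: (integrableZl measurableT k (integrable_gauss c b40)).
suff [k [k0 [kK kb]]] : exists k, 0 <= k /\ k <= K * N `^ s * P /\
    normc (osc (sym q b c) x) <= 2 * (k * I).
  apply: le_trans kb _; rewrite ler_wpM2l//.
  apply: le_trans (ler_wpM2r I0 kK) _.
  by rewrite le_eqVlt; apply/orP; left; apply/eqP; ring.
case: (@arg_maxP _ R _ i0 xpredT (fun i => `|x ord0 i|) isT) => j _ jmax.
have den i : 0 < 1 + x ord0 i ^+ 2 by rewrite ltr_pwDl// sqr_ge0.
have [x1|x1] := leP `|x ord0 j| 1.
  exists (C1 * N `^ s); split; first exact: mulr_ge0.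
  split; last first.
    apply: (bnd 0%N 0); [exact: mulr_ge0|by left|move=> xi].
    have := H1 N c j xi 0 N1 cN; rewrite normr0 expr0 mul1r pi_ge0 q2; exact.
  have P1 : 1 <= P.
    have <- : \prod_(i < d) (1 : R) = 1 by rewrite big1.
    apply: ler_prod => i _; rewrite ler01/= ler_pdivlMr// mul1r.
    rewrite (_ : 2 = 1 + 1)// lerD2l -(real_normK (num_real _)) expr_le1//.
    exact: le_trans (jmax i isT) x1.
  apply: (@le_trans _ _ (K * N `^ s)); last by rewrite ler_peMr// mulr_ge0.
  by rewrite ler_wpM2r// lerDl.
have xj0 : x ord0 j != 0 by rewrite -normr_gt0 (lt_trans ltr01).
have xi1 : `|x ord0 j|^-1 <= 1 by rewrite invf_le1 ?ltW// (lt_trans ltr01).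
set delta := pi / x ord0 j.
have dE : `|delta| = pi * `|x ord0 j|^-1 by rewrite normrM normfV ger0_norm
  ?pi_ge0.
exists (`|delta| ^+ (d + d) * (C2 * N `^ s)); split.
  by rewrite !mulr_ge0 ?exprn_ge0.
split; last first.
  apply: (bnd (d + d)%N (delta *: delta_mx ord0 j)).
  - by rewrite !mulr_ge0 ?exprn_ge0.
  - by right; rewrite dotC dotZl dotC dot_deltar /delta divfK.
  move=> xi; have := H2 N c j xi delta N1 cN; rewrite q2 [_ ^+ _ * _]mulrA;
    apply.
  by rewrite dE ler_piMr ?pi_ge0.
have Px : `|x ord0 j|^-1 ^+ (d + d) <= P.
  have -> : `|x ord0 j|^-1 ^+ (d + d) = \prod_(i < d) (x ord0 j ^+ 2)^-1.
    rewrite prodr_const card_ord addnn -mul2n exprM; congr (_ ^+ d).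
    by rewrite exprVn real_normK ?num_real.
  apply: ler_prod => i _; rewrite invr_ge0 sqr_ge0/= ler_pdivlMr//.
  rewrite mulrC ler_pdivrMr ?exprn_even_gt0//.
  rewrite mulr_natl mulr2n; apply: lerD.
    by rewrite -(real_normK (num_real (x ord0 j))) exprn_ege1// ltW.
  rewrite -(real_normK (num_real (x ord0 i)))
    -(real_normK (num_real (x ord0 j))).
  by rewrite lerXn2r ?nnegrE//; exact: jmax.
rewrite dE exprMn mulrACA.
apply: (@le_trans _ _ (pi ^+ (d + d) * C2 * (P * N `^ s))).
  by rewrite ler_wpM2l// ler_wpM2r.
have P0 : 0 <= P by apply: prodr_ge0 => i _; rewrite divr_ge0// ltW.
by rewrite [P * _]mulrC mulrA ler_wpM2r// ler_wpM2r// lerDr.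
Qed.

End bessel_wave.

(** * Bessel potentials of waves at high frequency *)

Section bessel_wave_high_frequency.
Context {R : realType} {d : nat}.
Local Notation L := (lebesgue_rV R d).
Local Open Scope complex_scope.
Import Normc.
Implicit Types (a b q s N : R) (c x xi : 'rV[R]_d).

Lemma dot_comb (s t : R) x xi : dot (s *: x + t *: xi) (s *: x + t *: xi) =
  s ^+ 2 * dot x x + 2 * s * t * dot x xi + t ^+ 2 * dot xi xi.
Proof.
rewrite /dot !mulr_sumr -!big_split; apply: eq_bigr => i _ /=; rewrite !mxE.
by ring.
Qed.

(** An integer power [m >= q] lies further from [1] than the power [q], on
    either side of [1], and [y ^ m - 1] has the factor [y - 1]. *)
Lemma powR_sub1_bound q y : 0 <= q -> 0 < y ->
  `|y `^ q - 1| <= (Num.trunc q).+1%:R * `|y - 1| * (1 + y) ^+ (Num.trunc q).+1.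
Proof.
move=> q0 y0; set m := (Num.trunc q).+1.
have qm : q <= m%:R by rewrite ltW// truncnS_gt.
have ym : y `^ m%:R = y ^+ m by rewrite powR_mulrn// ltW.
have step : `|y `^ q - 1| <= `|y ^+ m - 1|.
  rewrite -ym; have [y1|y1] := leP 1 y.
    have h : 1 <= y `^ q by rewrite -[leLHS](powRr0 y) ler_powR.
    have h2 : y `^ q <= y `^ m%:R by rewrite ler_powR.
    by rewrite !ger0_norm ?subr_ge0 ?(le_trans h)// lerD2r.
  have h : y `^ q <= 1.
    have <- : 1 `^ q = 1 :> R by rewrite powR1.
    apply: ge0_ler_powR => //; rewrite ?nnegrE ?ltW//.
  have h2 : y `^ m%:R <= y `^ q by rewrite ger_powR// y0 ltW.
  rewrite !ler0_norm ?subr_le0 ?(le_trans h2)//.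
  by rewrite lerN2 lerD2r.
apply: (le_trans step); rewrite subrX1 normrM [_%:R * _]mulrC -mulrA
  ler_wpM2l//.
apply: le_trans (ler_norm_sum _ _ _) _.
rewrite -[m in m%:R]card_ord -sumr_const mulr_suml; apply: ler_sum => i _.
rewrite mul1r ger0_norm ?exprn_ge0 ?(ltW y0)//.
have y1 : y <= 1 + y by rewrite lerDr.
apply: (@le_trans _ _ ((1 + y) ^+ i)).
  by rewrite lerXn2r ?nnegrE ?addr_ge0 ?(ltW y0).
by rewrite ler_weXn2l ?lerDl ?(ltW y0)//; exact: ltnW (ltn_ord i).
Qed.

(** Since [|c| = N], the quotient [bra xi / N ^ 2] is [1] up to an error of
    [2 bra (xi - c) / N]: this is where one power of [N] is gained. *)
Lemma powR_bra_sphere q N c xi : 0 <= q -> 1 <= N -> dot c c = N ^+ 2 ->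
  let m := (Num.trunc q).+1 in
  (`|bra xi `^ q - N `^ (2 * q)| <=
    (m%:R * 2 * 4 ^+ m) * N `^ (2 * q - 1) * bra (xi - c) ^+ m.+1)%R.
Proof.
move=> q0 N1 cN /=; set m := (Num.trunc q).+1;
  have N0 : 0 < N by exact: lt_le_trans N1.
have N20 : 0 < N ^+ 2 by rewrite exprn_gt0.
set y := bra xi / N ^+ 2; have y0 : 0 < y by rewrite divr_gt0// bra_gt0.
have bE : bra xi = N ^+ 2 * y by rewrite /y mulrC divfK// gt_eqF.
set w := bra (xi - c); have w1 : 1 <= w by exact: bra_ge1.
have w0 : 0 <= w by exact: le_trans w1.
have y3 : y <= 3 * w.
  rewrite ler_pdivrMr// mulrAC.
  by apply: bra_center => //; rewrite cN.
have dy : `|y - 1| <= 2 * w / N.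
  have -> : y - 1 = (w + 2 * dot c (xi - c)) / N ^+ 2.
    have := dot_comb 1 1 c (xi - c); rewrite !scale1r subrKC cN /y /w /bra =>
      ->.
    by field; rewrite gt_eqF.
  rewrite normrM normfV (ger0_norm (ltW N20)) ler_pdivrMr//.
  (* [2 c . (xi - c) <= N (1 + |xi - c|^2)] with both signs, from the square of
     [N (xi - c) - e c] *)
  have cs (e : R) : e ^+ 2 = 1 -> 2 * (e * dot c (xi - c)) <= N * w.
    move=> e2; have := dot_ge0 ((- e) *: c + N *: (xi - c)).
    rewrite dot_comb cN sqrrN e2.
    rewrite /w /bra; move: (dot c _) (dot (xi - c) _) => u v H.
    have : 0 <= N * (N * (1 + v) - 2 * (e * u)) by lra.
    by rewrite pmulr_rge0// subr_ge0.
  have h1 := cs 1 (expr1n _ _); have h2 := cs (-1)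
    (etrans (sqrrN 1) (expr1n _ _)).
  rewrite (_ : 2 * w / N * N ^+ 2 = N * w + N * w); last first.
    by field; rewrite gt_eqF.
  apply: le_trans (ler_normD _ _) _; apply: lerD.
    by rewrite ger0_norm// ler_peMl.
  by rewrite ler_norml; apply/andP; split; lra.
have NE : (N ^+ 2) `^ q = N `^ (2 * q) by rewrite -(powR_mulrn 2 (ltW N0))
  -powRrM.
rewrite bE powRM ?(ltW y0) ?(ltW N20)//
  NE -{2}[N `^ (2 * q)]mulr1 -mulrBr normrM.
rewrite (ger0_norm (powR_ge0 _ _)).
apply: le_trans (ler_wpM2l (powR_ge0 _ _) (powR_sub1_bound q0 y0)) _.
rewrite -/m powRB ?(gt_eqF N0) ?implybT// powRr1 ?(ltW N0)//.
have -> : m%:R * 2 * 4 ^+ m * (N `^ (2 * q) / N) * w ^+ m.+1 =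
    N `^ (2 * q) * (m%:R * (2 * w / N) * (4 * w) ^+ m).
  by rewrite exprMn [w ^+ m.+1]exprS; ring.
rewrite ler_wpM2l ?powR_ge0//; apply: ler_pM.
- by rewrite mulr_ge0.
- by rewrite exprn_ge0// addr_ge0// ltW.
- by rewrite ler_wpM2l.
- have y4 : 1 + y <= 4 * w by lra.
  have y1 : 0 <= 1 + y by rewrite addr_ge0// ltW.
  by rewrite lerXn2r ?nnegrE// (le_trans y1 y4).
Qed.

(** The Fourier transform of a wave is concentrated at distance [O(1)] of [c],
    where the symbol of [J^s] is [N ^ s] up to [O(N ^ (s - 1))]. *)
Lemma bessel_wave_approx a s : 0 < a -> 0 <= s -> exists C : R, 0 <= C /\
  forall N c x, 1 <= N -> dot c c = N ^+ 2 ->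
  normc (bessel s (wave a c) x - (N `^ s)%:C * wave a c x) <= C * N `^ (s - 1).
Proof.
move=> a0 s0; set b := (4 * a)^-1; set q := s / 2.
have b0 : 0 < b by rewrite invr_gt0 mulr_gt0.
have b20 : 0 < b / 2 by rewrite divr_gt0.
have q0 : 0 <= q by rewrite divr_ge0.
have q2 : 2 * q = s by rewrite /q; field.
set m := (Num.trunc q).+1; have [C [C0 H]] :=
  poly_gauss_absorb m.+1 b0 (d := d).
pose K : R := m%:R * 2 * 4 ^+ m.
have K0 : 0 <= K by rewrite !mulr_ge0 ?exprn_ge0.
pose I : R := Num.sqrt (pi / (b / 2)) ^+ d.
have I0 : 0 <= I by rewrite exprn_ge0 ?sqrtr_ge0.
exists (wave_coeff (d := d) a * (2 * (K * C * I))); split=> [|N c x N1 cN].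
  by rewrite mulr_ge0 ?wave_coeff_ge0// mulr_ge0// mulr_ge0// mulr_ge0.
have isym := integrable_sym c q0 b0; have ig := integrable_gauss c b0.
rewrite wave_osc// bessel_wave// mulrCA -mulrBr -/b -/q -oscZ// -oscB//;
  last first.
  exact: (integrableZl measurableT (N `^ s) ig).
rewrite normcM normc_real; move: (wave_coeff a) (wave_coeff_ge0 (d := d) a) =>
  w w0.
rewrite (ger0_norm w0) -[leRHS]mulrA ler_wpM2l//.
have E : 2 * (K * C * I) * N `^ (s - 1) =
    2 * \int[L]_xi (K * C * N `^ (s - 1) * gauss (b / 2) c xi).
  by rewrite RintegralZl ?Rintegral_gauss//;
    [rewrite /I; ring|exact: integrable_gauss].
rewrite E; apply: osc_bound.
- apply: measurable_funB; first exact: measurable_sym.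
  by apply: measurable_funM => //; exact: measurable_gauss.
- exact: (integrableZl measurableT (K * C * N `^ (s - 1))
  (integrable_gauss c b20)).
move=> xi; rewrite /sym -mulrBl normrM (ger0_norm (gauss_ge0 _ _ _)).
apply: (@le_trans _ _ (K * N `^ (s - 1)
  * (bra (xi - c) ^+ m.+1 * gauss b c xi))).
  rewrite mulrA ler_wpM2r ?gauss_ge0//.
  by have := powR_bra_sphere xi q0 N1 cN; rewrite q2.
rewrite [K * C * _]mulrAC -[leRHS]mulrA ler_wpM2l ?H// mulr_ge0// powR_ge0//.
Qed.

End bessel_wave_high_frequency.

(** * Bounds for the Lebesgue norms *)

Section Lp_norm_bounds.
Context {R : realType} {d : nat}.
Local Notation mu := (@lebesgue_measure R).
Local Notation L := (lebesgue_rV R d).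
Import Normc.
Implicit Types (u : 'rV[R]_d -> R[i]) (p A k : R).

Lemma integral_oneDsqrV : (\int[mu]_t ((1 + t ^+ 2)^-1)%:E = pi%:E)%E.
Proof.
rewrite (@ge0_symfun_integralT R (fun t => (oneDsqr t)^-1)); last 3 first.
- by move=> t; rewrite invr_ge0 (le_trans ler01)// oneDsqr_ge1.
- exact: continuous_oneDsqrV.
- by move=> t /=; rewrite /oneDsqr sqrrN.
rewrite -set_itvcy integral0y_oneDsqr -EFinM; congr (_%:E).
by field.
Qed.

Lemma cLnormE p u : cLnorm p%:E u =
  ((\int[L]_x (normc (u x) `^ p)%:E) `^ p^-1)%E.
Proof.
rewrite /cLnorm unlock; congr (_ `^ _)%E; apply: eq_integral => x _.
by rewrite gee0_abs ?lee_fin ?normc_ge0// poweR_EFin.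
Qed.

Lemma cLnorm_ge0 p u : (0 <= cLnorm p%:E u)%E.
Proof. exact: Lnorm_ge0. Qed.

(** With [V] the product of the [(1 + x_i ^ 2)^-1], [V ^ p <= V] as [V <= 1],
    and the integral of [V] is [pi ^ d]. *)
Lemma cLnorm_le_tensor p A u : 1 < p -> 0 <= A ->
  (forall x, normc (u x) <= A * \prod_i (2 / (1 + x ord0 i ^+ 2))) ->
  (cLnorm p%:E u <= (A * (2 ^+ d * (pi ^+ d) `^ p^-1))%:E)%E.
Proof.
move=> p1 A0 uA; have p0 : 0 < p by exact: lt_trans p1.
pose V (x : 'rV[R]_d) := \prod_i (1 + x ord0 i ^+ 2)^-1.
have V0 x : 0 <= V x.
  by apply: prodr_ge0 => i _; rewrite invr_ge0 addr_ge0// sqr_ge0.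
have B0 : 0 <= A * 2 ^+ d by rewrite mulr_ge0// exprn_ge0.
have uV x : normc (u x) `^ p <= (A * 2 ^+ d) `^ p * V x.
  have uV1 : normc (u x) <= A * 2 ^+ d * V x.
    apply: le_trans (uA x) _; rewrite big_split /= prodr_const card_ord mulrA.
    exact: lexx.
  apply: (@le_trans _ _ ((A * 2 ^+ d * V x) `^ p)).
    by apply: ge0_ler_powR; rewrite ?nnegrE ?normc_ge0 ?mulr_ge0 ?(ltW p0)//
      exprn_ge0.
  rewrite powRM// ler_wpM2l ?powR_ge0//.
  have V1 : V x <= 1.
    apply: (@le_trans _ _ (\prod_(i < d) (1 : R))); last by rewrite big1.
    apply: ler_prod => i _; rewrite invr_ge0 addr_ge0 ?sqr_ge0//=.
    by rewrite invf_le1 ?lerDl ?sqr_ge0// ltr_pwDl// sqr_ge0.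
  have [->|Vx] := eqVneq (V x) 0; first by rewrite powR0// gt_eqF.
  rewrite -[leRHS]powRr1//; apply: ger_powR; rewrite ?V1 ?(ltW p1)// andbT.
  by rewrite lt_neqAle eq_sym Vx V0.
have IV : (\int[L]_x (V x)%:E = (pi ^+ d)%:E)%E.
  rewrite (ge0_integral_rV_prod (h := fun _ t => (1 + t ^+ 2)^-1)).
  - by under eq_bigr do rewrite integral_oneDsqrV;
    rewrite prodEFin prodr_const card_ord.
  - by move=> _; apply: continuous_measurableR; exact: continuous_oneDsqrV.
  - by move=> _ t; rewrite invr_ge0 addr_ge0// sqr_ge0.
have mV : measurable_fun setT V.
  apply: measurable_prod => i _; apply:
    (measurableT_comp (f := fun t : R => (1 + t ^+ 2)^-1)).
    by apply: continuous_measurableR; exact: continuous_oneDsqrV.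
  exact: measurable_rV_entry.
rewrite cLnormE.
have -> : (A * (2 ^+ d * (pi ^+ d) `^ p^-1))%:E =
    (((A * 2 ^+ d) `^ p * pi ^+ d)%:E `^ p^-1)%E.
  rewrite poweR_EFin powRM ?powR_ge0 ?exprn_ge0 ?pi_ge0//
    -powRrM divff ?gt_eqF//.
  by rewrite powRr1// mulrA.
apply: gt0_ler_poweR; rewrite ?invr_ge0 ?(ltW p0)//.
- by rewrite in_itv/= leey andbT integral_ge0// => x _;
  rewrite lee_fin powR_ge0.
- by rewrite in_itv/= leey andbT lee_fin mulr_ge0 ?powR_ge0// exprn_ge0//
  pi_ge0.
rewrite EFinM -IV -ge0_integralZl//=; last 3 first.
- exact/measurable_EFinP.
- by move=> x _; rewrite lee_fin.
- by rewrite lee_fin powR_ge0.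
apply: ge0_le_integral_any => x; first by rewrite lee_fin powR_ge0.
by rewrite -EFinM lee_fin.
Qed.

Lemma cLnorm_ge_unit_cube p k u : 0 < p -> 0 <= k ->
  (forall x : 'rV[R]_d, (forall i, 0 <= x ord0 i <= 1) -> k <= normc (u x)) ->
  (k%:E <= cLnorm p%:E u)%E.
Proof.
move=> p0 k0 ku; rewrite cLnormE.
have -> : k%:E = ((k `^ p)%:E `^ p^-1)%E.
  by rewrite poweR_EFin -powRrM divff ?gt_eqF// powRr1.
apply: gt0_ler_poweR; rewrite ?invr_ge0 ?(ltW p0)//.
- by rewrite in_itv/= leey andbT lee_fin powR_ge0.
- by rewrite in_itv/= leey andbT integral_ge0// => x _;
  rewrite lee_fin powR_ge0.
pose h (t : R) : R := \1_(`[0, 1]%classic) t.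
have mh : measurable_fun setT h by exact: measurable_indic.
have h01 t : 0 <= h t by rewrite /h indicE ler0n.
have Ih : (\int[L]_x (\prod_i h (x ord0 i))%:E = 1)%E.
  rewrite (ge0_integral_rV_prod (h := fun _ => h))// big1// => i _.
  rewrite integral_indic// setIT; have /= :=
    lebesgue_measure_itv (`[0, 1] : interval R).
  by rewrite lte_fin ltr01 oppr0 adde0.
rewrite -[leLHS]mule1 -Ih -ge0_integralZl//=; last 3 first.
- apply/measurable_EFinP; apply: measurable_prod => i _.
  by apply: (measurableT_comp mh); exact: measurable_rV_entry.
- by move=> x _; rewrite lee_fin prodr_ge0.
- by rewrite lee_fin powR_ge0.
apply: ge0_le_integral_any => x; rewrite -EFinM lee_fin.
  by rewrite mulr_ge0 ?powR_ge0 ?prodr_ge0.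
have [xQ|/existsNP[i xi]] := pselect (forall i, 0 <= x ord0 i <= 1).
  rewrite big1 ?mulr1 => [|i _]; last by rewrite /h indicE mem_set//= in_itv/=;
    exact: xQ.
  apply: ge0_ler_powR; rewrite ?nnegrE ?normc_ge0 ?(ltW p0)//; exact: ku.
by rewrite (bigD1 i)//= {1}/h indicE memNset ?mul0r ?mulr0 ?powR_ge0.
Qed.

Lemma cLnorm_sup_le (k : R) u : 0 <= k -> (forall x, normc (u x) <= k) ->
  (cLnorm +oo u <= k%:E)%E.
Proof.
move=> k0 uk; rewrite /cLnorm unlock; case: ifP => [_|_];
  last by rewrite lee_fin.
apply/ess_supP; apply: nearW => x /=.
by rewrite lee_fin ger0_norm ?normc_ge0.
Qed.

End Lp_norm_bounds.

(** * Gaussians are Schwartz functions *)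

Section schwartz_gaussians.
Context {R : realType} {d : nat}.
Implicit Types (f g : 'rV[R]_d -> R^o) (a b : R) (c x : 'rV[R]_d).
Local Notation e_ i := (delta_mx ord0 i : 'rV[R]_d).

(** A class of bounded functions that is stable under differentiation and under
    multiplication by coordinates, so that its members are Schwartz
    functions. *)
Inductive gaussian_class : ('rV[R]_d -> R^o) -> Prop :=
| gc_cos a c : 0 < a -> gaussian_class (fun x => gauss a 0 x * cos (dot c x))
| gc_sin a c : 0 < a -> gaussian_class (fun x => gauss a 0 x * sin (dot c x))
| gc_X i f : gaussian_class f -> gaussian_class (fun x => x ord0 i * f x)
| gc_D f g : gaussian_class f -> gaussian_class g ->
    gaussian_class (fun x => f x + g x)
| gc_Z (k : R) f : gaussian_class f -> gaussian_class (fun x => k * f x).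

Lemma has_deriv_dotr c x i t : has_deriv (fun t => dot c (x + t *: e_ i))
  t (c ord0 i).
Proof.
have -> : (fun t => dot c (x + t *: e_ i)) = (fun t => dot c x + t * c ord0 i).
  by apply/funext => s; rewrite dotC dotDl dotZl ![dot _ c]dotC dot_deltar.
apply: has_deriv_eq (has_derivD (has_deriv_cst _ _)
  (has_derivM (has_deriv_id t) (has_deriv_cst (c ord0 i) t))) _.
by cbv beta; ring.
Qed.

Lemma has_deriv_gauss_line a x i t : has_deriv
  (fun t => gauss a 0 (x + t *: e_ i)) t
  (gauss a 0 (x + t *: e_ i) * (- (2 * a) * (x + t *: e_ i) ord0 i)).
Proof.
have H : has_deriv (fun t => - (a * dot (x + t *: e_ i - 0)
  (x + t *: e_ i - 0))) t
    (- (a * (2 * (x + t *: e_ i) ord0 i))).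
  apply: has_derivN; apply: has_derivZ.
  have := has_derivB (has_deriv_bra x i t) (has_deriv_cst 1 t).
  rewrite subr0; congr has_deriv; apply/funext => s.
  by rewrite /bra addrC addKr subr0.
by apply: has_deriv_eq (has_deriv_expR H) _; rewrite /gauss; ring.
Qed.

Lemma has_deriv_wave_cos a c x i t :
  has_deriv (fun t => gauss a 0 (x + t *: e_ i) * cos (dot c (x + t *: e_ i))) t
    (- (2 * a) * ((x + t *: e_ i) ord0 i *
        (gauss a 0 (x + t *: e_ i) * cos (dot c (x + t *: e_ i)))) +
     - c ord0 i * (gauss a 0 (x + t *: e_ i) * sin (dot c (x + t *: e_ i)))).
Proof.
apply: has_deriv_eq (has_derivM (has_deriv_gauss_line a x i t)
  (has_deriv_cos (has_deriv_dotr c x i t))) _.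
by cbv beta; ring.
Qed.

Lemma has_deriv_wave_sin a c x i t :
  has_deriv (fun t => gauss a 0 (x + t *: e_ i) * sin (dot c (x + t *: e_ i))) t
    (- (2 * a) * ((x + t *: e_ i) ord0 i *
        (gauss a 0 (x + t *: e_ i) * sin (dot c (x + t *: e_ i)))) +
     c ord0 i * (gauss a 0 (x + t *: e_ i) * cos (dot c (x + t *: e_ i)))).
Proof.
apply: has_deriv_eq (has_derivM (has_deriv_gauss_line a x i t)
  (has_deriv_sin (has_deriv_dotr c x i t))) _.
by cbv beta; ring.
Qed.

(** Partial derivatives are computed on lines, where the one-variable rules
    apply. *)
Lemma partial_line f i x (df : R) : has_deriv (fun t => f (x + t *: e_ i))
  0 df ->
  partial i f x = df.
Proof.
move=> [_ <-]; rewrite /partial /derive; apply: congr1.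
suff -> : (fun h : R => h^-1 *: ((f \o shift x) (h *: e_ i) - f x)) =
    (fun h : R => h^-1 *: (((fun t : R => f (x + t *: e_ i)) \o shift 0)
      (h *: 1) -
      f (x + 0 *: e_ i))) by [].
apply/funext => h /=; rewrite scale0r !addr0 [_ + x]addrC.
by rewrite (_ : h%:A = h :> R)//; exact: mulr1.
Qed.

Lemma gaussian_class_deriv f i : gaussian_class f -> exists2 df,
  gaussian_class df &
  forall x t, has_deriv (fun t => f (x + t *: e_ i)) t (df (x + t *: e_ i)).
Proof.
elim=> [a c a0|a c a0|j g gg [dg gdg Hg]|g h gg [dg gdg Hg] gh [dh gdh Hh]
  |k g gg [dg gdg Hg]].
- exists (fun x => - (2 * a) * (x ord0 i * (gauss a 0 x * cos (dot c x))) +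
     - c ord0 i * (gauss a 0 x * sin (dot c x))); last first.
    by move=> x t; exact: has_deriv_wave_cos.
  by apply: gc_D; apply: gc_Z; [apply: gc_X; exact: gc_cos|exact: gc_sin].
- exists (fun x => - (2 * a) * (x ord0 i * (gauss a 0 x * sin (dot c x))) +
     c ord0 i * (gauss a 0 x * cos (dot c x))); last first.
    by move=> x t; exact: has_deriv_wave_sin.
  by apply: gc_D; apply: gc_Z; [apply: gc_X; exact: gc_sin|exact: gc_cos].
- exists (fun x => x ord0 j * dg x + (j == i)%:R * g x).
    by apply: gc_D; [exact: gc_X|exact: gc_Z].
  move=> x t; have Hj : has_deriv (fun t => (x + t *: e_ i) ord0 j)
    t (j == i)%:R.
    have -> : (fun t => (x + t *: e_ i) ord0 j) =
      (fun t => x ord0 j + (j == i)%:R * t).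
      by apply/funext => s; rewrite !mxE eqxx mulrC.
    apply: has_deriv_eq (has_derivD (has_deriv_cst _ _)
      (has_derivZ (j == i)%:R (has_deriv_id t))) _.
    by rewrite add0r mulr1.
  by apply: has_deriv_eq (has_derivM Hj (Hg x t)) _; cbv beta; ring.
- exists (fun x => dg x + dh x); first exact: gc_D.
  by move=> x t; exact: has_derivD.
- exists (fun x => k * dg x); first exact: gc_Z.
  by move=> x t; exact: has_derivZ.
Qed.

Lemma gaussian_class_partial f i : gaussian_class f ->
  gaussian_class (partial i f).
Proof.
move=> gf; have [df gdf H] := gaussian_class_deriv i gf.
suff -> : partial i f = df by [].
by apply/funext => x; apply: partial_line; have := H x 0; rewrite scale0r addr0.
Qed.

Lemma differentiable_entry i x : differentiable
  (fun y : 'rV[R]_d => y ord0 i : R^o) x.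
Proof. exact: differentiable_coord. Qed.

Lemma differentiable_gauss a x : differentiable (gauss a 0 : 'rV[R]_d -> R^o) x.
Proof.
have -> : gauss a 0 = (expR : R^o -> R^o) \o
    (fun y : 'rV[R]_d => \sum_(i < d) (- a * (y ord0 i * y ord0 i)) : R^o).
  apply/funext => y /=; rewrite /gauss subr0 /dot mulr_sumr -sumrN; congr expR.
  by apply: eq_bigr => i _; rewrite mulNr.
apply: differentiable_comp; last by apply/derivable1_diffP;
  exact: derivable_expR.
have -> : (fun y : 'rV[R]_d => \sum_(i < d) (- a * (y ord0 i * y ord0 i)) : R^o)
  =
    \sum_(i < d) (fun y : 'rV[R]_d => - a * (y ord0 i * y ord0 i) : R^o).
  by apply/funext => y; rewrite fct_sumE.
apply: differentiable_sum => i.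
apply: (@differentiableZ _ _ _ (fun y : 'rV[R]_d => y ord0 i * y ord0 i : R^o)).
by apply: (@differentiableM _ _ (fun y : 'rV[R]_d => y ord0 i)
  (fun y : 'rV[R]_d => y ord0 i)); exact: differentiable_entry.
Qed.

Lemma differentiable_dot c x : differentiable
  (fun y : 'rV[R]_d => dot c y : R^o) x.
Proof.
have -> : (fun y : 'rV[R]_d => dot c y : R^o) =
    \sum_(i < d) (fun y : 'rV[R]_d => c ord0 i * y ord0 i : R^o).
  by apply/funext => y; rewrite fct_sumE.
apply: differentiable_sum => i.
apply: (@differentiableZ _ _ _ (fun y : 'rV[R]_d => y ord0 i : R^o)).
exact: differentiable_entry.
Qed.

Lemma gaussian_class_differentiable f x : gaussian_class f ->
  differentiable f x.
Proof.
elim=> [a c a0|a c a0|j g gg Hg|g h gg Hg gh Hh|k g gg Hg].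
- apply: (@differentiableM _ _ (gauss a 0) (fun y => cos (dot c y))).
    exact: differentiable_gauss.
  apply: (differentiable_comp (g := cos : R^o -> R^o));
    first exact: differentiable_dot.
  by apply/derivable1_diffP; exact: derivable_cos.
- apply: (@differentiableM _ _ (gauss a 0) (fun y => sin (dot c y))).
    exact: differentiable_gauss.
  apply: (differentiable_comp (g := sin : R^o -> R^o));
    first exact: differentiable_dot.
  by apply/derivable1_diffP; exact: derivable_sin.
- by apply: (@differentiableM _ _ (fun y : 'rV[R]_d => y ord0 j)) => //;
  exact: differentiable_entry.
- exact: differentiableD.
- exact: differentiableZ.
Qed.

Lemma ler_gauss a b x : a <= b -> gauss b 0 x <= gauss a 0 x :> R.
Proof. by move=> ab; rewrite /gauss ler_expR lerN2 ler_wpM2r// dot_ge0. Qed.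

(** The exponent [b] is not that of a single generator: a sum only decays like
    the flattest of its terms. *)
Lemma gaussian_class_decay f : gaussian_class f -> exists (C b : R) (n : nat),
  [/\ 0 <= C, 0 < b & forall x, `|f x| <= C * (bra x ^+ n * gauss b 0 x)].
Proof.
elim=> [a c a0|a c a0|j g gg [C [b [n [C0 b0 H]]]]
  |g h gg [C [b [n [C0 b0 H]]]] gh [C' [b' [n' [C0' b0' H']]]]
  |k g gg [C [b [n [C0 b0 H]]]]].
- exists 1, a, 0%N; split=> // x; rewrite expr0 !mul1r normrM ger0_norm
  ?gauss_ge0//.
  by rewrite ler_piMr ?gauss_ge0// ler_norm_cos.
- exists 1, a, 0%N; split=> // x; rewrite expr0 !mul1r normrM ger0_norm
  ?gauss_ge0//.
  by rewrite ler_piMr ?gauss_ge0// ler_norm_sin.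
- exists C, b, n.+1; split=> // x; rewrite normrM exprS -mulrA mulrCA.
  by apply: ler_pM => //; exact: norm_le_bra.
- exists (C + C'), (Num.min b b'), (n + n')%N; split; first exact: addr_ge0.
    by rewrite lt_min b0.
  move=> x; apply: le_trans (ler_normD _ _) _; rewrite mulrDl; apply: lerD.
    apply: le_trans (H x) _; rewrite ler_wpM2l//; apply: ler_pM.
    + by rewrite exprn_ge0// ltW// bra_gt0.
    + exact: gauss_ge0.
    + by rewrite ler_weXn2l ?bra_ge1// leq_addr.
    + by rewrite ler_gauss// ge_min lexx.
  apply: le_trans (H' x) _; rewrite ler_wpM2l//; apply: ler_pM.
  + by rewrite exprn_ge0// ltW// bra_gt0.
  + exact: gauss_ge0.
  + by rewrite ler_weXn2l ?bra_ge1// leq_addl.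
  + by rewrite ler_gauss// ge_min lexx orbT.
- exists (`|k| * C), b, n; split=> [||x]; rewrite ?mulr_ge0//.
  by rewrite normrM -mulrA ler_wpM2l.
Qed.

Lemma gaussian_class_bounded f : gaussian_class f -> exists C : R, forall x,
  `|f x| <= C.
Proof.
move=> /gaussian_class_decay[C [b [n [C0 b0 H]]]].
have [K [K0 HK]] := poly_gauss_absorb n b0 (d := d).
exists (C * K) => x; apply: le_trans (H x) _; rewrite ler_wpM2l//.
have := HK 0 x; rewrite subr0 => /le_trans; apply.
rewrite ler_piMr// -expR0 /gauss ler_expR oppr_le0 mulr_ge0 ?dot_ge0//.
by rewrite divr_ge0// ltW.
Qed.

Lemma gaussian_class_monomial (alpha : 'I_d -> nat) f : gaussian_class f ->
  gaussian_class (fun x => (\prod_(i < d) x ord0 i ^+ alpha i) * f x).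
Proof.
move=> gf.
have pow i n g : gaussian_class g -> gaussian_class
  (fun x => x ord0 i ^+ n * g x).
  move=> gg; elim: n => [|n IH].
    have -> : (fun x => x ord0 i ^+ 0 * g x) = g by apply/funext => x;
      rewrite mul1r.
    exact: gg.
  have -> : (fun x => x ord0 i ^+ n.+1 * g x) =
    (fun x => x ord0 i * (x ord0 i ^+ n * g x)).
    by apply/funext => x; rewrite exprS mulrA.
  exact: gc_X.
have H (s : seq 'I_d) :
    gaussian_class (fun x => (\prod_(i <- s) x ord0 i ^+ alpha i) * f x).
  elim: s => [|i s IH].
    have -> : (fun x => (\prod_(i <- [::]) x ord0 i ^+ alpha i) * f x) = f.
      by apply/funext => x; rewrite big_nil mul1r.
    exact: gf.
  have -> : (fun x => (\prod_(i <- i :: s) x ord0 i ^+ alpha i) * f x) =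
      (fun x => x ord0 i ^+ alpha i * ((\prod_(i <- s) x ord0 i ^+ alpha i)
        * f x)).
    by apply/funext => x; rewrite big_cons mulrA.
  exact: pow.
exact: H.
Qed.

Lemma gaussian_class_schwartz f : gaussian_class f -> schwartz_real f.
Proof.
move=> gf.
have gw (w : seq 'I_d) : gaussian_class (iter_partial w f).
  by elim: w => [//|i w IH]; exact: gaussian_class_partial.
split=> [w x|alpha w]; first exact: gaussian_class_differentiable.
exact: gaussian_class_bounded (gaussian_class_monomial alpha (gw w)).
Qed.

Lemma gaussian_class0 : gaussian_class (fun=> 0).
Proof.
have -> : (fun=> 0) = (fun x => 0 * (gauss 1 0 x * cos (dot 0 x)))
  :> ('rV[R]_d -> R^o).
  by apply/funext => x; rewrite mul0r.
by apply: gc_Z; exact: gc_cos.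
Qed.

Lemma gaussian_class_sum n (F : 'I_n -> 'rV[R]_d -> R^o) :
  (forall i, gaussian_class (F i)) -> gaussian_class (fun x => \sum_i F i x).
Proof.
elim: n F => [|n IH] F gF.
  have -> : (fun x => \sum_i F i x) = (fun=> 0).
    by apply/funext => x; rewrite big_ord0.
  exact: gaussian_class0.
have -> : (fun x => \sum_i F i x) = (fun x => F ord0 x + \sum_i F (lift ord0 i)
  x).
  by apply/funext => x; rewrite big_ord_recl.
by apply: gc_D => //; exact: IH.
Qed.

Lemma Re_wave a c x : complex.Re (wave a c x) = gauss a 0 x * cos (dot c x).
Proof. by rewrite /wave ReM /= mul0r subr0. Qed.

Lemma Im_wave a c x : complex.Im (wave a c x) = gauss a 0 x * sin (dot c x).
Proof. by rewrite /wave ImM /= mul0r addr0. Qed.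

Lemma schwartz_sum_wave n (a : 'I_n -> R) c : (forall i, 0 < a i) ->
  schwartz (fun x => \sum_i wave (a i) c x).
Proof.
move=> a0; split; apply: gaussian_class_schwartz.
  have -> : (fun x => complex.Re (\sum_i wave (a i) c x)) =
      (fun x => \sum_i (gauss (a i) 0 x * cos (dot c x))) :> ('rV[R]_d -> R^o).
    by apply/funext => x; rewrite Re_sum; apply: eq_bigr => i _;
      rewrite Re_wave.
  by apply: gaussian_class_sum => i; exact: gc_cos.
have -> : (fun x => complex.Im (\sum_i wave (a i) c x)) =
    (fun x => \sum_i (gauss (a i) 0 x * sin (dot c x))) :> ('rV[R]_d -> R^o).
  by apply/funext => x; rewrite Im_sum; apply: eq_bigr => i _; rewrite Im_wave.
by apply: gaussian_class_sum => i; exact: gc_sin.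
Qed.

Lemma schwartz_wave a c : 0 < a -> schwartz (wave a c).
Proof.
move=> a0; split; apply: gaussian_class_schwartz.
  have -> : (fun x => complex.Re (wave a c x)) =
      (fun x => gauss a 0 x * cos (dot c x)) :> ('rV[R]_d -> R^o).
    by apply/funext => x; rewrite Re_wave.
  exact: gc_cos.
have -> : (fun x => complex.Im (wave a c x)) =
    (fun x => gauss a 0 x * sin (dot c x)) :> ('rV[R]_d -> R^o).
  by apply/funext => x; rewrite Im_wave.
exact: gc_sin.
Qed.

Lemma entry_gauss_le1 x i : `|x ord0 i * gauss 1 0 x| <= 1 :> R.
Proof.
rewrite normrM (ger0_norm (gauss_ge0 _ _ _)) /gauss subr0 mul1r.
rewrite expRN ler_pdivrMr ?expR_gt0// mul1r.
by apply: le_trans (expR_ge1Dx _); exact: norm_le_bra.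
Qed.

(** The gradient grows only linearly in the frequency, while Bessel potentials
    of order [s > 1] grow like [N ^ s]. *)
Lemma grad_wave_bound N c : 0 <= N -> dot c c <= N ^+ 2 ->
  (grad_sup_norm (wave 1 c) <= (d%:R * (2 * (2 + N)))%:E)%E.
Proof.
move=> N0 cN.
have cb i : `|c ord0 i| <= N.
  rewrite -(@ler_pXn2r _ 2)// ?nnegrE// real_normK ?num_real//.
  exact: le_trans (sqr_le_dot c i) cN.
have part (u v : R) i x : `|u| <= 1 -> `|v| <= 1 ->
    `| - (2 * 1) * (x ord0 i * (gauss 1 0 x * u)) + c ord0 i * (gauss 1 0 x * v)
      | <= 2 + N.
  move=> u1 v1; apply: le_trans (ler_normD _ _) _; apply: lerD.
    have e1 : `|x ord0 i * (gauss 1 0 x * u)| <= 1.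
      by rewrite mulrA normrM mulr_ile1//; exact: entry_gauss_le1.
    by rewrite normrM normrN mulr1 (ger0_norm (ler0n _ 2)) ler_piMr.
  rewrite normrM; apply: le_trans (ler_wpM2r _ (cb i)) _ => //.
  rewrite ler_piMr// normrM mulr_ile1// ger0_norm ?gauss_ge0//.
  by rewrite /gauss mul1r -expR0 ler_expR oppr_le0 dot_ge0.
have -> : (d%:R * (2 * (2 + N)))%:E = (\sum_(i < d) (2 * (2 + N))%:E)%E.
  by rewrite sumEFin sumr_const card_ord mulr_natl.
rewrite /grad_sup_norm; apply: lee_sum => i _.
apply: cLnorm_sup_le => [|x]; first by rewrite mulr_ge0// addr_ge0.
apply: le_trans (normc_leD _) _; rewrite mulr_natl mulr2n /cpartial /=.
have pc : partial i (fun y => complex.Re (wave 1 c y)) x =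
    - (2 * 1) * (x ord0 i * (gauss 1 0 x * cos (dot c x))) +
     c ord0 i * (gauss 1 0 x * - sin (dot c x)).
  apply: partial_line; have := has_deriv_wave_cos 1 c x i 0.
  rewrite scale0r addr0; under [X in _ -> has_deriv X _ _]eq_fun do rewrite
    Re_wave.
  by move=> H; apply: has_deriv_eq H _; ring.
have ps : partial i (fun y => complex.Im (wave 1 c y)) x =
    - (2 * 1) * (x ord0 i * (gauss 1 0 x * sin (dot c x))) +
     c ord0 i * (gauss 1 0 x * cos (dot c x)).
  apply: partial_line; have := has_deriv_wave_sin 1 c x i 0.
  rewrite scale0r addr0; under [X in _ -> has_deriv X _ _]eq_fun do rewrite
    Im_wave.
  by [].
by apply: lerD; [rewrite pc|rewrite ps]; apply: part;
  rewrite ?normrN ?ler_norm_sin ?ler_norm_cos.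
Qed.

End schwartz_gaussians.

(** * A logarithmic bump of bounded mean oscillation *)

Section mean_oscillation_finite_measure.
Context dd (T : measurableType dd) (R : realType)
  (mu : {measure set T -> \bar R}).
Variables (Q : set T) (V : R).
Hypotheses (mQ : measurable Q) (muQ : mu Q = V%:E) (V0 : 0 < V).
Implicit Types (v : T -> R).

Definition mean v : R := V^-1 * \int[mu]_(x in Q) v x.
Definition mean_osc v : R := V^-1 * \int[mu]_(x in Q) `|v x - mean v|.

Definition bounded_measurable v := measurable_fun setT v /\ exists C, forall x,
  `|v x| <= C.

Lemma bounded_measurable_cst k : bounded_measurable (fun=> k).
Proof. by split; [exact: measurable_cst|exists `|k|]. Qed.

Lemma bounded_measurableD u v : bounded_measurable u -> bounded_measurable v ->
  bounded_measurable (fun x => u x + v x).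
Proof.
move=> [mu' [C HC]] [mv [D HD]]; split; first exact: measurable_funD.
by exists (C + D) => x; apply: le_trans (ler_normD _ _) _; exact: lerD.
Qed.

Lemma bounded_measurable_norm v : bounded_measurable v ->
  bounded_measurable (fun x => `|v x|).
Proof.
move=> [mv [C HC]]; split; first exact: measurableT_comp.
by exists C => x; rewrite normr_id.
Qed.

Lemma bounded_measurable_integrable v : bounded_measurable v ->
  mu.-integrable Q (EFin \o v).
Proof.
move=> [mv [C HC]]; apply: measurable_bounded_integrable => //.
- by rewrite muQ ltry.
- exact: measurable_funS mv.
exists C; split; first exact: num_real.
by move=> y Cy x _ /=; apply: le_trans (HC x) (ltW Cy).
Qed.

Lemma Rintegral_cstQ k : \int[mu]_(x in Q) k = k * V.
Proof. by rewrite Rintegral_cst// muQ. Qed.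

Lemma mean_cst k : mean (fun=> k) = k.
Proof. by rewrite /mean Rintegral_cstQ mulrC mulfK// gt_eqF. Qed.

Lemma le_mean u v : bounded_measurable u -> bounded_measurable v ->
  (forall x, Q x -> u x <= v x) ->
  mean u <= mean v.
Proof.
move=> tu tv uv; rewrite ler_wpM2l ?invr_ge0 ?(ltW V0)//.
by apply: le_Rintegral => //; exact: bounded_measurable_integrable.
Qed.

Lemma meanD u v : bounded_measurable u -> bounded_measurable v ->
  mean (fun x => u x + v x) = mean u + mean v.
Proof. by move=> tu tv; rewrite /mean RintegralD ?mulrDr//;
  exact: bounded_measurable_integrable. Qed.

Lemma bounded_measurable_sub v : bounded_measurable v ->
  bounded_measurable (fun x => `|v x - mean v|).
Proof. by move=> tv; apply: bounded_measurable_norm;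
  apply: bounded_measurableD => //; exact: bounded_measurable_cst. Qed.

Lemma mean_oscD u v : bounded_measurable u -> bounded_measurable v ->
  mean_osc (fun x => u x + v x) <= mean_osc u + mean_osc v.
Proof.
move=> tu tv; rewrite /mean_osc -/(mean _) -[X in _ <= X + _]/(mean _)
  -[X in _ <= _ + X]/(mean _).
rewrite -meanD; try exact: bounded_measurable_sub.
apply: le_mean.
- by apply: bounded_measurable_sub; exact: bounded_measurableD.
- by apply: bounded_measurableD; exact: bounded_measurable_sub.
by move=> x _; rewrite meanD// opprD addrACA ler_normD.
Qed.

Lemma mean_osc0 : mean_osc (fun=> 0) = 0.
Proof. by rewrite /mean_osc mean_cst subrr normr0 -/(mean _) mean_cst. Qed.

Lemma bounded_measurable_sum n (v : 'I_n -> T -> R) :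
  (forall i, bounded_measurable (v i)) ->
  bounded_measurable (fun x => \sum_i v i x).
Proof.
elim: n v => [|n IH] v tv.
  have -> : (fun x => \sum_i v i x) = (fun=> 0) by apply/funext => x;
    rewrite big_ord0.
  exact: bounded_measurable_cst.
have -> : (fun x => \sum_i v i x) = (fun x => v ord0 x + \sum_i v (lift ord0 i)
  x).
  by apply/funext => x; rewrite big_ord_recl.
by apply: bounded_measurableD => //; exact: IH.
Qed.

Lemma mean_osc_sum n (v : 'I_n -> T -> R) : (forall i, bounded_measurable (v i))
  ->
  mean_osc (fun x => \sum_i v i x) <= \sum_i mean_osc (v i).
Proof.
elim: n v => [|n IH] v tv.
  have -> : (fun x => \sum_i v i x) = (fun=> 0) by apply/funext => x;
    rewrite big_ord0.
  by rewrite mean_osc0 big_ord0.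
have -> : (fun x => \sum_i v i x) = (fun x => v ord0 x + \sum_i v (lift ord0 i)
  x).
  by apply/funext => x; rewrite big_ord_recl.
rewrite big_ord_recl; apply: le_trans (mean_oscD _ _) _ => //;
  first exact: bounded_measurable_sum.
by rewrite lerD2l; exact: IH.
Qed.

Lemma mean_osc_le_osc v (w : R) : bounded_measurable v ->
  (forall x y, Q x -> Q y -> `|v x - v y| <= w) ->
  mean_osc v <= w.
Proof.
move=> tv vw; rewrite -[leRHS]mean_cst; apply: le_mean;
  [exact: bounded_measurable_sub|exact: bounded_measurable_cst|].
move=> x Qx; rewrite ler_distlC; apply/andP; split.
- rewrite -[leLHS]mean_cst; apply: le_mean => //;
  first exact: bounded_measurable_cst.
  by move=> y Qy; have := vw x y Qx Qy; rewrite ler_distlC => /andP[].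
- rewrite -[leRHS]mean_cst; apply: le_mean => //;
  first exact: bounded_measurable_cst.
  by move=> y Qy; have := vw x y Qx Qy; rewrite ler_distlC => /andP[].
Qed.

Lemma mean_osc_le_mean v : bounded_measurable v -> (forall x, 0 <= v x) ->
  mean_osc v <= 2 * mean v.
Proof.
move=> tv v0; have m0 : 0 <= mean v.
  by rewrite -[leLHS](mean_cst 0); apply: le_mean => //;
    exact: bounded_measurable_cst.
rewrite mulr_natl mulr2n -{2}(mean_cst (mean v)) -meanD//;
  last exact: bounded_measurable_cst.
apply: le_mean; [exact: bounded_measurable_sub|by apply: bounded_measurableD =>
  //; exact: bounded_measurable_cst|].
move=> x _; apply: le_trans (ler_normB _ _) _.
by rewrite !ger0_norm.
Qed.

End mean_oscillation_finite_measure.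

Section gaussian_bmo.
Context {R : realType} {d : nat}.
Local Notation L := (lebesgue_rV R d).
Local Notation mu := (@lebesgue_measure R).
Local Open Scope complex_scope.
Implicit Types (a x y : 'rV[R]_d) (l r : R).

Lemma cubeE a l :
  cube a l = [set x | forall i, `[a ord0 i, a ord0 i + l]%classic (x ord0 i)].
Proof. by apply/seteqP; split => x /= H i; have := H i; rewrite in_itv. Qed.

Lemma measurable_cube a l : measurable (cube a l).
Proof.
have -> : cube a l = \bigcap_(i in [set: 'I_d])
    (rV_coord i @^-1` `[a ord0 i, a ord0 i + l]%classic).
  rewrite cubeE; apply/seteqP; split => x /= Ax i; first by move=> _; exact: Ax.
  exact: (Ax i).
apply: fin_bigcap_measurable => // i _.
by rewrite -[X in measurable X]setTI; exact: measurable_rV_coord.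
Qed.

Lemma lebesgue_side (s l : R) : 0 < l -> mu `[s, s + l]%classic = l%:E.
Proof.
move=> l0; have /= -> := lebesgue_measure_itv (`[s, s + l] : interval R).
by rewrite lte_fin ltrDl l0 -EFinD addrAC subrr add0r.
Qed.

Lemma measure_cube a l : 0 < l -> L (cube a l) = (l ^+ d)%:E.
Proof.
move=> l0; rewrite cubeE.
rewrite (lebesgue_rV_box (A := fun i => `[a ord0 i, a ord0 i + l]%classic))//.
by under eq_bigr do rewrite lebesgue_side//;
  rewrite prodEFin prodr_const card_ord.
Qed.

Lemma volume_cube a l : 0 < l -> volume (cube a l) = l ^+ d.
Proof. by move=> l0; rewrite /volume measure_cube. Qed.

Lemma mean_oscillation_real a l (v : 'rV[R]_d -> R) : 0 < l ->
  bounded_measurable v ->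
  mean_oscillation (cube a l) (fun x => (v x)%:C) =
  (mean_osc L (cube a l) (l ^+ d) v)%:E.
Proof.
move=> l0 tv; have mQ := measurable_cube a l; have LQ := measure_cube a l0.
have ld0 : 0 < l ^+ d by rewrite exprn_gt0.
have avg : average (cube a l) (fun x => (v x)%:C) =
  (mean L (cube a l) (l ^+ d) v)%:C.
  rewrite /average volume_cube// /mean realcM; congr (_ * _).
  by apply: complexP => //=; rewrite /Rintegral integral0.
rewrite /mean_oscillation volume_cube// /mean_osc EFinM; congr (_ * _)%E.
rewrite /Rintegral fineK; last first.
  by apply: integrable_fin_num => //; exact:
    (bounded_measurable_integrable mQ LQ (bounded_measurable_sub _ _ _ tv)).
apply: eq_integral => x _; rewrite avg -normc_real; congr (Normc.normc _)%:E.
by apply: complexP; rewrite ?ReD ?ImD /= ?oppr0 ?addr0.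
Qed.

Lemma bounded_measurable_gauss (b : R) : 0 <= b ->
  bounded_measurable (gauss b 0 : 'rV[R]_d -> R).
Proof.
move=> b0; split; first exact: measurable_gauss.
exists 1 => x; rewrite ger0_norm ?gauss_ge0// /gauss -expR0 ler_expR oppr_le0.
by rewrite mulr_ge0// dot_ge0.
Qed.

Lemma ler_dist_prod (I : Type) (s : seq I) (p q : I -> R) :
  (forall i, 0 <= p i <= 1) -> (forall i, 0 <= q i <= 1) ->
  `|\prod_(i <- s) p i - \prod_(i <- s) q i| <= \sum_(i <- s) `|p i - q i|.
Proof.
move=> p01 q01; elim: s => [|i s IH]; first by rewrite !big_nil subrr normr0.
rewrite !big_cons.
have -> : p i * \prod_(j <- s) p j - q i * \prod_(j <- s) q j =
    (p i - q i) * \prod_(j <- s) p j + q i *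
      (\prod_(j <- s) p j - \prod_(j <- s) q j).
  by ring.
apply: le_trans (ler_normD _ _) _; rewrite !normrM; apply: lerD.
  rewrite ler_piMr// ger0_norm; last by apply: prodr_ge0 => j _;
    have /andP[] := p01 j.
  elim: {IH} s => [|j s IH]; first by rewrite big_nil.
  have /andP[p0 p1] := p01 j.
  rewrite big_cons mulr_ile1//; apply: prodr_ge0 => k _;
    by have /andP[] := p01 k.
have /andP[q0 q1] := q01 i.
by apply: le_trans IH; rewrite ler_piMl// ger0_norm.
Qed.

Lemma gauss1_lipschitz r (s t : R) : 0 < r ->
  `|gauss1 (r ^+ 2) 0 s - gauss1 (r ^+ 2) 0 t| <= r * `|s - t|.
Proof.
move=> r0; wlog st : s t / s <= t.
  move=> H; have [|/ltW ts] := leP s t; first exact: H.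
  by rewrite distrC [`|s - t|]distrC; exact: H.
rewrite distrC [`|s - t|]distrC.
pose dg u := gauss1 (r ^+ 2) 0 u * (- (r ^+ 2 * (2 * (u - 0)))).
have [||u _ ->] := @MVT_segment R (gauss1 (r ^+ 2) 0) dg s t st.
- by move=> u _; exact: has_deriv_gauss1.
- by apply: continuous_subspaceT => u; exact:
  has_deriv_continuous (has_deriv_gauss1 _ _ u).
rewrite normrM ler_wpM2r// /dg normrM normrN subr0
  (ger0_norm (ltW (gauss1_gt0 _ _ _))).
rewrite /gauss1 subr0 expRN mulrC ler_pdivrMr ?expR_gt0//.
rewrite (_ : r ^+ 2 * (2 * u) = r * (2 * (r * u))); last by ring.
rewrite normrM (ger0_norm (ltW r0)) ler_wpM2l ?(ltW r0)//
  normrM (ger0_norm (ler0n _ 2)).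
apply: le_trans (expR_ge1Dx _); rewrite -exprMn
  -(real_normK (num_real (r * u))).
by have := sqr_ge0 (`|r * u| - 1); move: `|r * u| => z; nra.
Qed.

(** A cube small compared to the scale [1 / r] of the Gaussian. *)
Lemma mean_osc_gauss_small r a l : 0 < r -> 0 < l ->
  mean_osc L (cube a l) (l ^+ d) (gauss (r ^+ 2) 0) <= d%:R * (r * l).
Proof.
move=> r0 l0; have ld0 : 0 < l ^+ d by rewrite exprn_gt0.
apply: (mean_osc_le_osc (measurable_cube a l) (measure_cube a l0) ld0).
  by apply: bounded_measurable_gauss; exact: sqr_ge0.
move=> x y Qx Qy; rewrite !gauss_prod.
have g01 (z : 'rV[R]_d) i : 0 <= gauss1 (r ^+ 2) ((0 : 'rV[R]_d) ord0 i)
  (z ord0 i) <= 1.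
  by rewrite (ltW (gauss1_gt0 _ _ _)) gauss1_le1// sqr_ge0.
apply: le_trans (ler_dist_prod _ (g01 x) (g01 y)) _.
rewrite mulr_natl -[X in _ *+ X]card_ord -sumr_const; apply: ler_sum => i _.
rewrite mxE; apply: le_trans (gauss1_lipschitz _ _ r0) _.
rewrite ler_wpM2l ?(ltW r0)//.
have /andP[x1 x2] := Qx i; have /andP[y1 y2] := Qy i.
by rewrite ler_norml; apply/andP; split; lra.
Qed.

(** A cube large compared to the scale [1 / r]: the Gaussian has a small mean,
    already by integration in one of the variables. *)
Lemma mean_osc_gauss_large r a l (i0 : 'I_d) : 0 < r -> 0 < l ->
  mean_osc L (cube a l) (l ^+ d) (gauss (r ^+ 2) 0) <= 4 / (r * l).
Proof.
move=> r0 l0; have ld0 : 0 < l ^+ d by rewrite exprn_gt0.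
have r2 : 0 < r ^+ 2 by rewrite exprn_gt0.
have tg : bounded_measurable (gauss (r ^+ 2) 0 : 'rV[R]_d -> R) by apply:
  bounded_measurable_gauss; exact: sqr_ge0.
have mQ := measurable_cube a l; have LQ := measure_cube a l0.
apply: le_trans (mean_osc_le_mean mQ LQ ld0 tg _) _; first by move=> x;
  exact: gauss_ge0.
pose h (i : 'I_d) (t : R) : R :=
  gauss1 (r ^+ 2) 0 t * \1_(`[a ord0 i, a ord0 i + l]%classic) t.
have mh i : measurable_fun setT (h i).
  by apply: measurable_funM; [exact: measurable_gauss1|exact: measurable_indic].
have h0 i t : 0 <= h i t by rewrite mulr_ge0 ?(ltW (gauss1_gt0 _ _ _))//
  indicE ler0n.
have E : (\int[L]_(x in cube a l) (gauss (r ^+ 2) 0 x)%:E =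
  \prod_i \int[mu]_t (h i t)%:E)%E.
  rewrite -ge0_integral_rV_prod// integral_mkcond; apply: eq_integral => x _.
  rewrite patchE; case: ifPn => [|].
    rewrite inE => Qx; congr (_%:E); rewrite gauss_prod; apply: eq_bigr => i _.
    by rewrite /h mxE indicE mem_set ?mulr1//= in_itv/=; exact: Qx.
  rewrite notin_setE => /existsNP[i xi]; rewrite (bigD1 i)//= {1}/h indicE.
  by rewrite memNset ?mulr0 ?mul0r.
have hl i : (\int[mu]_t (h i t)%:E <= l%:E)%E.
  have -> : l%:E = (\int[mu]_t (\1_(`[a ord0 i, a ord0 i + l]%classic) t)%:E)%E.
    by rewrite integral_indic// setIT; exact/esym/lebesgue_side.
  apply: ge0_le_integral_any => t; rewrite lee_fin//.
  by rewrite /h ler_piMl ?indicE ?ler0n// gauss1_le1// ltW.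
have hr i : (\int[mu]_t (h i t)%:E <= (2 / r)%:E)%E.
  apply: (@le_trans _ _ (\int[mu]_t (gauss1 (r ^+ 2) 0 t)%:E)%E).
    apply: ge0_le_integral_any => t; rewrite lee_fin// /h.
    by rewrite ler_piMr ?(ltW (gauss1_gt0 _ _ _))// indicE lern1 leq_b1.
  rewrite integral_gauss1// lee_fin -[leRHS]ger0_norm ?divr_ge0 ?(ltW r0)//
    -sqrtr_sqr.
  rewrite ler_wsqrtr// exprMn exprVn ler_wpM2r ?invr_ge0 ?sqr_ge0//.
  have := pihalf_lt2 R; rewrite ltr_pdivrMr// => /ltW; rewrite expr2; exact.
have h0e i : (0 <= \int[mu]_t (h i t)%:E)%E.
  by apply: integral_ge0 => t _; rewrite lee_fin.
have I : (\int[L]_(x in cube a l) (gauss (r ^+ 2) 0 x)%:E <=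
  (2 / r * l ^+ d.-1)%:E)%E.
  have [P0 Pl] : (0 <= \prod_(i < d | i != i0) \int[mu]_t (h i t)%:E)%E /\
      (\prod_(i < d | i != i0) \int[mu]_t (h i t)%:E <= \prod_(i < d | i != i0)
        l%:E)%E.
    apply: (big_ind2 (fun y z : \bar R => (0 <= y)%E /\ (y <= z)%E)) => //.
    move=> y1 z1 y2 z2 [y10 yz1] [y20 yz2]; split; first exact: mule_ge0.
    exact: lee_pmul.
  rewrite E (bigD1 i0)//= EFinM; apply: lee_pmul => //.
  apply: le_trans Pl _; rewrite prodEFin prodr_const lee_fin.
  by have := cardC1 i0; rewrite card_ord => ->.
have d0 : (0 < d)%N by case: d i0 => [[]|].
have {}I : \int[L]_(x in cube a l) gauss (r ^+ 2) 0 x <= 2 / r * l ^+ d.-1.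
  rewrite -lee_fin /Rintegral fineK//.
  by apply: integrable_fin_num => //; exact:
    (bounded_measurable_integrable mQ LQ tg).
rewrite /mean; apply: (@le_trans _ _ (2 * ((l ^+ d)^-1 * (2 / r * l ^+ d.-1)))).
  by rewrite ler_wpM2l// ler_wpM2l// invr_ge0 ltW.
rewrite -(prednK d0) exprS /= le_eqVlt; apply/orP; left; apply/eqP.
by field; rewrite expf_neq0 ?gt_eqF.
Qed.

(** With [F y = y / (1 + y)], which takes its values in [0, 1], the sum of
    [min (y, 1 / y)] over a dyadic progression is dominated by the telescoping
    sum of [6 (F y - F (y / 2))]. *)
Lemma dyadic_telescope (y m : R) : 0 < y -> m <= y -> m <= y^-1 ->
  m <= 6 * (y / (1 + y) - y / 2 / (1 + y / 2)).
Proof.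
move=> y0 my my'.
have -> : 6 * (y / (1 + y) - y / 2 / (1 + y / 2)) = 6 * y / ((1 + y) * (2 + y)).
  by field; rewrite !gt_eqF ?addr_gt0 ?mulr_gt0.
have D0 : 0 < (1 + y) * (2 + y) by rewrite mulr_gt0 ?addr_gt0.
rewrite ler_pdivlMr//; have [y1|y1] := leP y 1.
  apply: le_trans (ler_wpM2r (ltW D0) my) _; nra.
apply: le_trans (ler_wpM2r (ltW D0) my') _.
by rewrite mulrC ler_pdivrMr//; nra.
Qed.

(** The Gaussians of widths [1, 2, 4, ..., 2 ^ (n - 1)]: a smooth substitute for
    the truncated logarithm [log (2 ^ n / |x|)], of which each term stands for
    one dyadic scale. *)
Definition log_bump n (x : 'rV[R]_d) : R[i] :=
  \sum_(j < n) wave ((2^-1 ^+ j) ^+ 2) 0 x.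

Lemma log_bumpE n x :
  log_bump n x = (\sum_(j < n) gauss ((2^-1 ^+ j) ^+ 2) 0 x)%:C.
Proof.
rewrite /log_bump realc_sum; apply: eq_bigr => j _; rewrite /wave.
have -> : dot (0 : 'rV[R]_d) x = 0 by rewrite /dot big1// => i _;
  rewrite mxE mul0r.
by rewrite cis0 mulr1.
Qed.

(** Only the terms whose width is comparable to the side of the cube oscillate
    substantially on it: the wider ones are nearly constant and the narrower
    ones have a small mean, both with geometric gain. *)
Lemma BMO_log_bump (i0 : 'I_d) n : (BMO_norm (log_bump n)
  <= (6 * (d%:R + 4))%:E)%E.
Proof.
have p0 j : 0 < 2^-1 ^+ j :> R by rewrite exprn_gt0.
apply: ge_ereal_sup => _ [a [l [l0 ->]]].
have tg (j : 'I_n) : bounded_measurable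
  (gauss ((2^-1 ^+ j) ^+ 2) 0 : 'rV[R]_d -> R).
  by apply: bounded_measurable_gauss; exact: sqr_ge0.
have -> : log_bump n = (fun x => (\sum_(j < n) gauss ((2^-1 ^+ j) ^+ 2)
  0 x)%:C).
  by apply/funext => x; exact: log_bumpE.
rewrite mean_oscillation_real//; last exact: bounded_measurable_sum.
have ld0 : 0 < l ^+ d by rewrite exprn_gt0.
have K0 : 0 < d%:R + 4 :> R by rewrite addr_gt0 ?ltr0n//; case: d i0 => [[]|].
rewrite lee_fin; apply: le_trans (mean_osc_sum (measurable_cube a l)
  (measure_cube a l0) ld0 tg) _.
pose y j := 2^-1 ^+ j * l; have y0 j : 0 < y j by rewrite mulr_gt0.
pose F j := y j / (1 + y j).
have F0 j : 0 <= F j by rewrite divr_ge0 ?addr_ge0 ?(ltW (y0 j)).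
have F1 : F 0%N <= 1 by rewrite ler_pdivrMr ?addr_gt0// mul1r lerDr.
have term j : mean_osc L (cube a l) (l ^+ d) (gauss ((2^-1 ^+ j) ^+ 2) 0) <=
    (d%:R + 4) * (6 * (F j - F j.+1)).
  have yS : y j.+1 = y j / 2 by rewrite /y exprS; ring.
  rewrite /F yS -ler_pdivrMl// mulrC; apply: dyadic_telescope => //.
    rewrite ler_pdivrMr// mulrC; apply:
      le_trans (mean_osc_gauss_small a (p0 j) l0) _.
    by rewrite ler_wpM2r ?(ltW (y0 j))// lerDl.
  rewrite ler_pdivrMr// mulrC; apply: le_trans
    (mean_osc_gauss_large a i0 (p0 j) l0) _.
  by rewrite ler_wpM2r ?invr_ge0 ?(ltW (y0 j))// lerDr.
apply: (@le_trans _ _ ((d%:R + 4) * (6 * (F 0%N - F n)))).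
  elim: n {tg} => [|n IH]; first by rewrite big_ord0 subrr !mulr0.
  rewrite big_ord_recr /=; apply: le_trans (lerD IH (term n)) _.
  by rewrite le_eqVlt; apply/orP; left; apply/eqP; ring.
rewrite mulrCA ler_wpM2l// ler_piMr ?(ltW K0)//.
by apply: le_trans F1; rewrite gerBl.
Qed.

End gaussian_bmo.

(** * The counterexample *)

Section counterexample.
Context {R : realType} {d : nat}.
Local Open Scope complex_scope.
Import Normc.
Implicit Types (a b r N p : R) (c x : 'rV[R]_d).

Lemma BMO_norm_ge0 (u : 'rV[R]_d -> R[i]) : (0 <= BMO_norm u)%E.
Proof.
apply: (@le_trans _ _ (mean_oscillation (cube (0 : 'rV[R]_d) 1) u)).
  apply: mule_ge0; first by rewrite lee_fin invr_ge0 fine_ge0.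
  by apply: integral_ge0 => x _; rewrite lee_fin normc_ge0.
by apply: ereal_sup_ubound; exists (0 : 'rV[R]_d), 1; split.
Qed.

Lemma grad_sup_norm_ge0 (u : 'rV[R]_d -> R[i]) : (0 <= grad_sup_norm u)%E.
Proof. by apply: sume_ge0 => i _; exact: Lnorm_ge0. Qed.

Lemma wave_mul a b c x : wave a c x * wave b 0 x = wave (a + b) c x.
Proof.
rewrite /wave (_ : dot 0 x = 0); last by rewrite /dot big1// => i _;
  rewrite mxE mul0r.
rewrite cis0 mulr1 mulrAC -realcM; congr (_%:C * _).
by rewrite /gauss -expRD; congr expR; ring.
Qed.

Lemma normc_wave a c x : normc (wave a c x) = gauss a 0 x.
Proof. by rewrite /wave normcM normc_cis mulr1 normc_real ger0_norm//
  gauss_ge0. Qed.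

Lemma wave_log_bump n c x :
  wave 1 c x * log_bump n x = \sum_(j < n) wave (1 + (2^-1 ^+ j) ^+ 2) c x.
Proof. by rewrite /log_bump mulr_sumr; apply: eq_bigr => j _;
  rewrite wave_mul. Qed.

Let scale_gt0 n (j : 'I_n) : 0 < (2^-1 ^+ j) ^+ 2 :> R.
Proof. by rewrite !exprn_gt0. Qed.

Let scale1_gt0 n (j : 'I_n) : 0 < 1 + (2^-1 ^+ j) ^+ 2 :> R.
Proof. by rewrite addr_gt0// scale_gt0. Qed.

Lemma bessel_log_bump_decay (i0 : 'I_d) n r : 0 <= r -> exists C : R, 0 <= C /\
  forall x, normc (bessel r (log_bump n) x)
    <= C * \prod_i (2 / (1 + x ord0 i ^+ 2)).
Proof.
move=> r0.
have [C HC] := choice (fun j : 'I_n => bessel_wave_decay i0 (scale_gt0 j) r0).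
exists (\sum_j C j); split; first by apply: sumr_ge0 => j _; have [] := HC j.
move=> x; rewrite (bessel_sum_wave (a := fun j : 'I_n => (2^-1 ^+ j) ^+ 2))//.
apply: le_trans (ler_normc_sum _ _) _; rewrite mulr_suml; apply: ler_sum => j _.
have [_ /(_ 1 0 x (lexx 1))] := HC j; rewrite powR1 mulr1; apply.
by rewrite /dot big1 ?expr1n// => i _; rewrite mxE mul0r.
Qed.

(** A wave of frequency [c] times the bump is a sum of waves of the same
    frequency, whose Bessel potentials add up in phase to [N ^ s] times the
    product. *)
Lemma bessel_product_approx n s : 0 <= s -> exists C : R, 0 <= C /\
  forall N c x, 1 <= N -> dot c c = N ^+ 2 ->
  N `^ s * \sum_(j < n) gauss (1 + (2^-1 ^+ j) ^+ 2) 0 x - C * N `^ (s - 1) <=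
  normc (bessel s (fun y => wave 1 c y * log_bump n y) x).
Proof.
move=> s0.
have [C HC] := choice (fun j : 'I_n => bessel_wave_approx (d := d)
  (scale1_gt0 j) s0).
exists (\sum_j C j); split; first by apply: sumr_ge0 => j _; have [] := HC j.
move=> N c x N1 cN.
have -> : (fun y => wave 1 c y * log_bump n y) =
    (fun y => \sum_(j < n) wave (1 + (2^-1 ^+ j) ^+ 2) c y).
  by apply/funext => y; exact: wave_log_bump.
rewrite (bessel_sum_wave (a := fun j : 'I_n => 1 + (2^-1 ^+ j) ^+ 2))//.
set S := \sum_j bessel _ _ _.
pose W := \sum_(j < n) (N `^ s)%:C * wave (1 + (2^-1 ^+ j) ^+ 2) c x.
have WE : normc W = N `^ s * \sum_(j < n) gauss (1 + (2^-1 ^+ j) ^+ 2) 0 x.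
  rewrite /W -mulr_sumr normcM normc_real ger0_norm ?powR_ge0//; congr (_ * _).
  rewrite /wave -mulr_suml normcM normc_cis mulr1 -realc_sum normc_real
    ger0_norm//.
  by apply: sumr_ge0 => j _; exact: gauss_ge0.
have SW : normc (W - S) <= (\sum_j C j) * N `^ (s - 1).
  rewrite -normcN opprB /S /W -sumrB; apply: le_trans (ler_normc_sum _ _) _.
  by rewrite mulr_suml; apply: ler_sum => j _; have [_] := HC j; apply.
rewrite -WE lerBlDr -lerBlDl; apply: le_trans SW.
by apply: ler_normcB.
Qed.

Lemma sum_gauss_unit_cube n x : (forall i, 0 <= x ord0 i <= 1) ->
  n%:R * expR (- (2 * d%:R)) <= \sum_(j < n) gauss (1 + (2^-1 ^+ j) ^+ 2)
    0 x :> R.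
Proof.
move=> xQ; have xd : dot x x <= d%:R.
  rewrite -[leRHS](_ : \sum_(i < d) (1 : R) = _);
    last by rewrite sumr_const card_ord.
  apply: ler_sum => i _; have /andP[x0 x1] := xQ i.
  by rewrite mulr_ile1.
rewrite mulr_natl -[X in _ *+ X]card_ord -sumr_const; apply: ler_sum => j _.
rewrite /gauss subr0 ler_expR lerN2; apply: ler_pM => //.
  exact: dot_ge0.
have h : (2^-1 ^+ j) ^+ 2 <= 1 :> R.
  by rewrite !exprn_ile1 ?exprn_ge0// invf_le1// ler1n.
by lra.
Qed.

(** [N ^ s] is the product of [N] and [N ^ (s - 1)], both of which tend to
    infinity. *)
Lemma high_frequency (s D : R) : 1 < s -> 0 <= D -> exists N : R,
  1 <= N /\ D * N `^ (s - 1) + D + D * N < N `^ s.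
Proof.
move=> s1 D0; have s10 : 0 < s - 1 by rewrite subr_gt0.
pose N0 := 3 * D + 1; have N01 : 1 <= N0 by rewrite lerDr mulr_ge0.
pose N := Num.max N0 (N0 `^ (s - 1)^-1).
have NN0 : N0 <= N by rewrite le_max lexx.
have N1 : 1 <= N by exact: le_trans NN0.
have N00 : 0 <= N0 by exact: le_trans N01.
exists N; split => //.
have vN : N0 <= N `^ (s - 1).
  have E : (N0 `^ (s - 1)^-1) `^ (s - 1) = N0.
    by rewrite -powRrM mulVf ?gt_eqF// powRr1.
  rewrite -[leLHS]E; apply: ge0_ler_powR;
    rewrite ?nnegrE ?powR_ge0 ?(ltW s10)//.
    exact: le_trans N1.
  by rewrite le_max lexx orbT.
have -> : N `^ s = N * N `^ (s - 1).
  rewrite mulr_powRB1// ?(lt_trans ltr01)//; exact: le_trans N1.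
move: (N `^ (s - 1)) N1 NN0 vN; rewrite /N0 => v; move: N => u u1 uD vD.
have v1 : 1 <= v by apply: le_trans vD; rewrite lerDr mulr_ge0.
have h1 := ler_wpM2r (le_trans ler01 v1) uD.
have h2 := ler_wpM2r (le_trans ler01 u1) vD.
have h3 := ler_wpM2l (le_trans ler01 u1) v1.
nra.
Qed.

End counterexample.

Theorem proposition7p9 (R : realType) (d : nat) (p s : R)
    (hd : (1 <= d)%N) (hp : 1 < p) (hs : 1 + d%:R / p < s) :
  forall M : R, 0 < M ->
  exists f g : 'rV[R]_d -> R[i],
    [/\ schwartz f, schwartz g &
      (M%:E * (cLnorm p%:E (bessel s f) * BMO_norm g +
               cLnorm p%:E (bessel (s - 1) g) * grad_sup_norm f) <
       cLnorm p%:E (fun x => (bessel s (fun y => f y * g y) x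
                              - f x * bessel s g x)%R))%E].
Proof.
move=> M M0; pose i0 : 'I_d := Ordinal hd.
have p0 : 0 < p by exact: lt_trans hp.
have s1 : 1 < s by apply: le_lt_trans hs; rewrite lerDl divr_ge0// ltW.
have s0 : 0 <= s by rewrite ltW// (lt_trans ltr01).
have s10 : 0 <= s - 1 by rewrite subr_ge0 ltW.
pose B : R := 6 * (d%:R + 4); have B0 : 0 <= B by rewrite mulr_ge0// addr_ge0.
pose E : R := 2 ^+ d * (pi ^+ d) `^ p^-1.
have E0 : 0 <= E by rewrite mulr_ge0 ?exprn_ge0 ?powR_ge0.
have [C1 [C10 HC1]] := bessel_wave_decay i0 ltr01 s0.
(* [n] makes the main term beat the [BMO] term; it is fixed before [N] *)
pose e : R := expR (2 * d%:R).
pose n := (Num.trunc ((M * (C1 * E * B) + 1) * e)).+1.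
have ne : M * (C1 * E * B) + 1 <= n%:R * expR (- (2 * d%:R)).
  by rewrite expRN ler_pdivlMr ?expR_gt0// ltW// truncnS_gt.
have [C2 [C20 HC2]] := bessel_log_bump_decay i0 n s0.
have [C3 [C30 HC3]] := bessel_log_bump_decay i0 n s10.
have [C4 [C40 HC4]] := @bessel_product_approx R d n s s0.
pose G : R := 6 * d%:R * M * (C3 * E).
have CE0 : 0 <= C3 * E by exact: mulr_ge0.
have G0 : 0 <= G by apply: mulr_ge0 => //; apply: mulr_ge0;
  [exact: mulr_ge0|exact: ltW].
have T0 : 0 <= C2 * 2 ^+ d by rewrite mulr_ge0// exprn_ge0.
(* the other terms have constants that depend on [n] but are of order at most
   [N ^ (s - 1)] or [N], so that a large frequency makes them negligible *)
have [|N [N1 HN]] := @high_frequency R s (C4 + C2 * 2 ^+ d + G) s1.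
  by rewrite !addr_ge0.
have N0 : 0 <= N by exact: le_trans N1.
pose c : 'rV[R]_d := N *: delta_mx ord0 i0.
have cN : dot c c = N ^+ 2 by rewrite /c dotZl dotC dotZl dot_delta mulr1 expr2.
exists (wave 1 c), (log_bump n); split.
- exact: schwartz_wave.
- by apply: schwartz_sum_wave => j; rewrite !exprn_gt0.
set lhs := (M%:E * _)%E.
have upper : (lhs <= (M * (C1 * N `^ s * E * B + C3 * E *
  (d%:R * (2 * (2 + N)))))%:E)%E.
  rewrite EFinM lee_pmul2l ?lte_fin// EFinD leeD// EFinM; apply: lee_pmul.
  - exact: cLnorm_ge0.
  - exact: BMO_norm_ge0.
  - apply: cLnorm_le_tensor => // [|x]; first by rewrite mulr_ge0// powR_ge0.
    by apply: HC1 => //; rewrite cN.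
  - exact: BMO_log_bump.
  - exact: cLnorm_ge0.
  - exact: grad_sup_norm_ge0.
  - exact: cLnorm_le_tensor.
  - by apply: grad_wave_bound => //; rewrite cN.
apply: (le_lt_trans upper).
have Ns : 0 <= N `^ s by exact: powR_ge0.
have Ns1 : 0 <= N `^ (s - 1) by exact: powR_ge0.
(* a lower bound for the commutator on the unit cube *)
pose K : R := N `^ s * (n%:R * expR (- (2 * d%:R))) - C4 * N `^ (s - 1)
  - C2 * 2 ^+ d.
have key : M * (C1 * N `^ s * E * B + C3 * E * (d%:R * (2 * (2 + N)))) < K.
  have h1 : N `^ s * (M * (C1 * E * B) + 1)
    <= N `^ s * (n%:R * expR (- (2 * d%:R))).
    by rewrite ler_wpM2l.
  have h2 : M * (C3 * E * (d%:R * (2 * (2 + N)))) <= G * N.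
    have -> : M * (C3 * E * (d%:R * (2 * (2 + N)))) =
        2 * (d%:R * M * (C3 * E)) * (2 + N) by ring.
    have -> : G * N = 2 * (d%:R * M * (C3 * E)) * (3 * N) by rewrite /G; ring.
    have t0 : 0 <= 2 * (d%:R * M * (C3 * E)).
      by rewrite mulr_ge0// mulr_ge0// mulr_ge0// ltW.
    by rewrite ler_wpM2l//; lra.
  have h3 : C4 * N `^ (s - 1) <= (C4 + C2 * 2 ^+ d + G) * N `^ (s - 1).
    by rewrite ler_wpM2r// -addrA lerDl addr_ge0.
  have h4 : G * N <= (C4 + C2 * 2 ^+ d + G) * N.
    by rewrite ler_wpM2r// lerDr addr_ge0.
  have h5 : C2 * 2 ^+ d <= C4 + C2 * 2 ^+ d + G by rewrite -addrA addrCA lerDl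
    addr_ge0.
  rewrite /K; move: h1 h2 h3 h4 h5 HN.
  move: (N `^ s) (N `^ (s - 1)) (n%:R * _) (C4 + _ + G) (G * N) => u v w D GN.
  move: (C2 * _) => C2'; rewrite !mulrDr.
  have -> : M * (C1 * u * E * B) = u * (M * (C1 * E * B)) by ring.
  by rewrite mulr1; lra.
have K0 : 0 <= K.
  apply: le_trans (ltW key); rewrite mulr_ge0 ?(ltW M0)// addr_ge0//.
    by rewrite mulr_ge0// mulr_ge0// mulr_ge0.
  by rewrite mulr_ge0// mulr_ge0// mulr_ge0// addr_ge0.
apply: (@lt_le_trans _ _ K%:E); first by rewrite lte_fin.
apply: cLnorm_ge_unit_cube => // x xQ.
apply: le_trans (ler_normcB _ _); rewrite /K.
apply: lerB.
  apply: le_trans (HC4 N c x N1 cN); rewrite lerB// ler_wpM2l//.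
  exact: sum_gauss_unit_cube.
rewrite Normc.normcM normc_wave; apply: (@le_trans _ _ (1 * (C2 * 2 ^+ d)));
  last by rewrite mul1r.
apply: ler_pM; rewrite ?gauss_ge0 ?normc_ge0//.
  by rewrite /gauss mul1r -expR0 ler_expR oppr_le0 dot_ge0.
apply: le_trans (HC2 x) _; rewrite ler_wpM2l//.
rewrite -[X in _ <= _ ^+ X]card_ord -prodr_const; apply: ler_prod => i _.
have q0 : 0 < 1 + x ord0 i ^+ 2 by rewrite ltr_pwDl// sqr_ge0.
rewrite divr_ge0 ?(ltW q0)//= ler_pdivrMr// ler_peMr// lerDl sqr_ge0//.
Qed.
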